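(* Let $A\in\mathbb{Q}_{\mathbb{R}}^{m\times n}$, $B\in\mathbb{Q}_{\mathbb{R}}^{m\times d}$, $C\in\mathbb{Q}_{\mathbb{R}}^{p\times n}$, $D\in\mathbb{Q}_{\mathbb{R}}^{p\times d}$, with $m\ge n+d$ and $C^R_c$ of full row rank. Let $\hat P,\hat S,\hat Q_2,\hat U_1,\hat U_2,\hat\Sigma_1,\hat\Sigma_2,\check V_1,\check V_{22}$ be the matrices built from $(A,B,C,D)$ as specified in the context, and assume that the singular values of $\hat P\hat Q_2$ satisfy $$\hat{\sigma}_1\ge\cdots\ge\hat{\sigma}_{n-4p}>\hat{\sigma}_{n-4p+1}\ge\cdots\ge\hat{\sigma}_{n-4p+d}>0$$ and that $\check{V}_{22}$ is invertible. Let $X_{RT}$ be the (unique) real RBTLSE solution for $(A,B,C,D)$. Let $\hat{S}=\hat{U}_s\hat{S}_s\hat{V}_s^T$ be the skinny SVD of $\hat{S}$. Define $$Q_r=\begin{bmatrix} -(\hat{P}\hat{S}^{\dagger})^T \\ I_{4m} \end{bmatrix},\quad S_r=\begin{bmatrix} \hat{S}_s & 0 \\ 0 & \hat{\Sigma}_1 \end{bmatrix},\quad W_r=[\hat{V}_s,\ \check{V}_1]=\begin{bmatrix} W_{1r} \\ W_{2r} \end{bmatrix},\ W_{1r}\in\mathbb{R}^{n\times n},\ W_{2r}\in\mathbb{R}^{d\times n}.$$ Then the relative normwise condition number of $X_{RT}$ is $$k^{rel}_r(X_{RT},J,K)=\|H_rG_rZ_r\|_2\,\frac{\|[J_r,K_r]\|_F}{\|X_{RT}\|_F},$$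 where $$H_r=\left(\check{V}_{22}^{-T}\otimes W_{1r}^{-T}\right)\Pi_{(d,n)},$$ $$G_r=\left((S_r^2\otimes I_d)-\begin{bmatrix} 0_{4p} & 0 \\ 0 & I_{n-4p} \end{bmatrix}\otimes(\hat{\Sigma}_2^T\hat{\Sigma}_2)\right)^{-1}\left[I_n\otimes\hat{\Sigma}_2^T,\ S_r\otimes I_d\right],$$ $$Z_r=\mathrm{diag}\left(\begin{bmatrix} 0_{4p} & 0 \\ 0 & I_{n-4p} \end{bmatrix}\otimes(\hat{U}_2^TQ_r^T),\ \begin{bmatrix} I_{4p} & 0 \\ -\hat{U}_1^T(\hat{P}\hat{S}^{\dagger})\hat{U}_s & I_{n-4p} \end{bmatrix}\otimes I_d\right).$$
   Context: $\mathbb{Q}_{\mathbb{R}}$ denotes the reduced biquaternions: the commutative real algebra with basis $1,\mathbf{i},\mathbf{j},\mathbf{k}$ and $\mathbf{j}^2=1$, $\mathbf{i}^2=\mathbf{k}^2=-1$, $\mathbf{i}\mathbf{j}=\mathbf{j}\mathbf{i}=\mathbf{k}$, $\mathbf{j}\mathbf{k}=\mathbf{k}\mathbf{j}=\mathbf{i}$, $\mathbf{k}\mathbf{i}=\mathbf{i}\mathbf{k}=-\mathbf{j}$. For $\alpha=\alpha_0+\alpha_1\mathbf{i}+\alpha_2\mathbf{j}+\alpha_3\mathbf{k}$ ($\alpha_t\in\mathbb{R}$), $\|\alpha\|=\sqrt{\alpha_0^2+\alpha_1^2+\alpha_2^2+\alpha_3^2}$; for $P=(p_{ij})\in\mathbb{Q}_{\mathbb{R}}^{m\times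 n}$, $\|P\|_F=\sqrt{\sum_{i,j}\|p_{ij}\|^2}$. Real matrices are regarded as reduced biquaternion matrices. $\|\cdot\|_2$ is the spectral norm, $\dagger$ the Moore–Penrose inverse, $\otimes$ the Kronecker product, $\mathrm{diag}(\cdot,\cdot)$ a block diagonal matrix, $0_{4p}$ the $4p\times4p$ zero matrix, and $\Pi_{(d,n)}=\sum_{i=1}^d\sum_{j=1}^nE_{ij}\otimes E_{ij}^T\in\mathbb{R}^{dn\times dn}$, where $E_{ij}\in\mathbb{R}^{d\times n}$ has a $1$ in position $(i,j)$ and zeros elsewhere. For $P=P_0+P_1\mathbf{i}+P_2\mathbf{j}+P_3\mathbf{k}\in\mathbb{Q}_{\mathbb{R}}^{m\times n}$ with $P_t\in\mathbb{R}^{m\times n}$, put $P^R_c=[P_0^T,P_1^T,P_2^T,P_3^T]^T\in\mathbb{R}^{4m\times n}$. Real RBTLSE solution for $(A,B,C,D)$: consider the problem $$\min_{X,\bar{E},\bar{F}}\|[\bar{E},\bar{F}]\|_F\quad\text{subject to}\quad (A+\bar{E})X=B+\bar{F},\quad CX=D,$$ over $X\in\mathbb{R}^{n\times d}$, $\bar{E}\in\mathbb{Q}_{\mathbb{R}}^{m\times n}$, $\bar{F}\in\mathbb{Q}_{\mathbb{R}}^{m\times d}$. A real matrix $X$ that satisfies the constraints together with perturbations $\bar E,\bar F$ attaining the minimum is a real RBTLSE solution. Matrices: $\hat{P}=[A^R_c,B^R_c]\in\mathbb{R}^{4m\times(n+d)}$, $\hat{S}=[C^R_c,D^R_c]\in\mathbb{R}^{4p\times(n+d)}$.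 QR factorization $\hat{S}^T=\hat{Q}\begin{bmatrix} \hat{R} \\ 0 \end{bmatrix}$ with $\hat{Q}=[\hat{Q}_1,\hat{Q}_2]$ orthogonal, $\hat{Q}_1\in\mathbb{R}^{(n+d)\times4p}$, $\hat{Q}_2\in\mathbb{R}^{(n+d)\times(n+d-4p)}$. Thin SVD $\hat{P}\hat{Q}_2=\hat{U}\hat{\Sigma}\hat{V}^T$ with $\hat{U}=[\hat{U}_1,\hat{U}_2]\in\mathbb{R}^{4m\times(n-4p+d)}$, $\hat{V}=[\hat{V}_1,\hat{V}_2]\in\mathbb{R}^{(n-4p+d)\times(n-4p+d)}$ (column blocks of sizes $n-4p$ and $d$), $\hat{\Sigma}=\mathrm{diag}(\hat{\Sigma}_1,\hat{\Sigma}_2)$, $\hat{\Sigma}_1=\mathrm{diag}(\hat\sigma_1,\ldots,\hat\sigma_{n-4p})$, $\hat{\Sigma}_2=\mathrm{diag}(\hat\sigma_{n-4p+1},\ldots,\hat\sigma_{n-4p+d})$. $\check{V}=\hat{Q}_2\hat{V}=[\check{V}_1,\check{V}_2]=\begin{bmatrix} \check{V}_{11} & \check{V}_{12} \\ \check{V}_{21} & \check{V}_{22} \end{bmatrix}$ with row blocks of sizes $n,d$ and column blocks of sizes $n-4p,d$. In the skinny SVD of $\hat S$ (which has rank $4p$), $\hat{U}_s\in\mathbb{R}^{4p\times4p}$, $\hat{S}_s\in\mathbb{R}^{4p\times4p}$ is diagonal, $\hat{V}_s\in\mathbb{R}^{(n+d)\times4p}$. Concatenated matrices: $J=\begin{bmatrix}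 C \\ A \end{bmatrix}$, $K=\begin{bmatrix} D \\ B \end{bmatrix}$, $J_r=\begin{bmatrix} C^R_c \\ A^R_c \end{bmatrix}$, $K_r=\begin{bmatrix} D^R_c \\ B^R_c \end{bmatrix}$. Condition number: for reduced biquaternion perturbations $\Delta A,\Delta B,\Delta C,\Delta D$ of the same sizes as $A,B,C,D$, put $\Delta J=\begin{bmatrix} \Delta C \\ \Delta A \end{bmatrix}$, $\Delta K=\begin{bmatrix} \Delta D \\ \Delta B \end{bmatrix}$; let $\widehat{X}_{RT}$ be the real RBTLSE solution for $(A+\Delta A,B+\Delta B,C+\Delta C,D+\Delta D)$ (perturbations are assumed sufficiently small), and $\Delta X_{RT}=X_{RT}-\widehat{X}_{RT}$. Then, for $X_{RT}\neq0$, $$k^{rel}_r(X_{RT},J,K)=\lim_{\epsilon\to0}\sup\left\{\frac{\|\Delta X_{RT}\|_F}{\epsilon\|X_{RT}\|_F}\ :\ \|[\Delta J,\Delta K]\|_F\le\epsilon\|[J,K]\|_F\right\}.$$ *)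

(* Defs.v *)
From HB Require Import structures.
From mathcomp Require Import all_boot all_order all_algebra.
From mathcomp Require Import ring.
From mathcomp Require Import all_classical all_reals all_analysis.
From mathcomp Require Export mxtens.

Set Implicit Arguments.
Unset Strict Implicit.
Unset Printing Implicit Defensive.

Import Order.TTheory GRing.Theory Num.Theory.
Import numFieldNormedType.Exports.
Local Open Scope classical_set_scope.
Local Open Scope ring_scope.

(** * Reduced biquaternions *)

Record rbquat (R : Type) := RBQuat { rbre : R; rbi : R; rbj : R; rbk : R }.

Section RBQuatChoice.
Variable R : choiceType.

Definition rbquat_prod (a : rbquat R) : R * R * R * R :=
  (rbre a, rbi a, rbj a, rbk a).
Definition prod_rbquat (t : R * R * R * R) : rbquat R :=
  RBQuat t.1.1.1 t.1.1.2 t.1.2 t.2.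
Lemma rbquat_prodK : cancel rbquat_prod prod_rbquat.
Proof. by case. Qed.

HB.instance Definition _ := Choice.copy (rbquat R) (can_type rbquat_prodK).

End RBQuatChoice.

Section RBQuatRing.
Variable R : comNzRingType.
Implicit Types a b c : rbquat R.

Definition rb_zero : rbquat R := RBQuat 0 0 0 0.
Definition rb_opp a := RBQuat (- rbre a) (- rbi a) (- rbj a) (- rbk a).
Definition rb_add a b :=
  RBQuat (rbre a + rbre b) (rbi a + rbi b) (rbj a + rbj b) (rbk a + rbk b).

Lemma rb_addA : associative rb_add.
Proof. by case=> ? ? ? ? [? ? ? ?] [? ? ? ?]; rewrite /rb_add /= !addrA. Qed.
Lemma rb_addC : commutative rb_add.
Proof. by case=> ? ? ? ? [? ? ? ?]; congr RBQuat; rewrite /= addrC. Qed.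
Lemma rb_add0 : left_id rb_zero rb_add.
Proof. by case=> ? ? ? ?; rewrite /rb_add /= !add0r. Qed.
Lemma rb_addN : left_inverse rb_zero rb_opp rb_add.
Proof. by case=> ? ? ? ?; rewrite /rb_add /= !addNr. Qed.

HB.instance Definition _ :=
  GRing.isZmodule.Build (rbquat R) rb_addA rb_addC rb_add0 rb_addN.

Definition rb_one : rbquat R := RBQuat 1 0 0 0.
Definition rb_mul a b :=
  RBQuat
    (rbre a * rbre b - rbi a * rbi b + rbj a * rbj b - rbk a * rbk b)
    (rbre a * rbi b + rbi a * rbre b + rbj a * rbk b + rbk a * rbj b)
    (rbre a * rbj b + rbj a * rbre b - rbi a * rbk b - rbk a * rbi b)
    (rbre a * rbk b + rbk a * rbre b + rbi a * rbj b + rbj a * rbi b).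

Lemma rb_mulA : associative rb_mul.
Proof. by case=> ? ? ? ? [? ? ? ?] [? ? ? ?]; congr RBQuat => /=; ring. Qed.
Lemma rb_mulC : commutative rb_mul.
Proof. by case=> ? ? ? ? [? ? ? ?]; congr RBQuat => /=; ring. Qed.
Lemma rb_mul1 : left_id rb_one rb_mul.
Proof. by case=> ? ? ? ?; congr RBQuat => /=; ring. Qed.
Lemma rb_mulD : left_distributive rb_mul rb_add.
Proof. by case=> ? ? ? ? [? ? ? ?] [? ? ? ?]; congr RBQuat => /=; ring. Qed.
Lemma rb_one_neq0 : rb_one != rb_zero.
Proof. by apply/eqP => -[] /eqP; rewrite oner_eq0. Qed.

HB.instance Definition _ := GRing.Zmodule_isComNzRing.Build (rbquat R)
  rb_mulA rb_mulC rb_mul1 rb_mulD rb_one_neq0.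

Definition rb_i : rbquat R := RBQuat 0 1 0 0.
Definition rb_j : rbquat R := RBQuat 0 0 1 0.
Definition rb_k : rbquat R := RBQuat 0 0 0 1.

Lemma rb_mul_table :
  [/\ rb_j * rb_j = 1, rb_i * rb_i = -1 & rb_k * rb_k = -1] /\
  [/\ rb_i * rb_j = rb_k, rb_j * rb_k = rb_i & rb_k * rb_i = - rb_j].
Proof. by split; split; congr RBQuat => /=; ring. Qed.

Definition rb_real (x : R) : rbquat R := RBQuat x 0 0 0.

End RBQuatRing.

(* [4p] in the shape produced by stacking four blocks with [col_mx]. *)
Notation quad p := (p + (p + (p + p)))%N.

Definition rbcol (R : Type) m n (P : 'M[rbquat R]_(m, n)) :
    'M[R]_(quad m, n) :=
  col_mx (map_mx (@rbre R) P) (col_mx (map_mx (@rbi R) P)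
    (col_mx (map_mx (@rbj R) P) (map_mx (@rbk R) P))).

(** * Norms *)

Section Norms.
Variable R : realType.

Definition rbnorm (a : rbquat R) : R :=
  Num.sqrt (rbre a ^+ 2 + rbi a ^+ 2 + rbj a ^+ 2 + rbk a ^+ 2).

Definition frob m n (M : 'M[R]_(m, n)) : R :=
  Num.sqrt (\sum_i \sum_j M i j ^+ 2).

Definition rbfrob m n (P : 'M[rbquat R]_(m, n)) : R :=
  Num.sqrt (\sum_i \sum_j rbnorm (P i j) ^+ 2).

(* On column vectors [frob] is the Euclidean norm. *)
Definition specnorm m n (M : 'M[R]_(m, n)) : R :=
  sup [set frob (M *m x) | x in [set x : 'cV[R]_n | frob x <= 1]].

End Norms.

(** * Matrix factorizations *)

Section Factorizations.
Variable R : realType.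

Definition is_pinv m n (M : 'M[R]_(m, n)) (N : 'M[R]_(n, m)) : Prop :=
  [/\ M *m N *m M = M, N *m M *m N = N,
      (M *m N)^T = M *m N & (N *m M)^T = N *m M].

(* The widths [r1 + r2] and [l] of the two sides of the orthogonality
   relation need not be convertible, hence the two equations. *)
Definition is_qr l r1 r2 (M : 'M[R]_(l, r1)) (Q1 : 'M[R]_(l, r1))
    (Q2 : 'M[R]_(l, r2)) (T : 'M[R]_r1) : Prop :=
  let Q := row_mx Q1 Q2 in
  [/\ Q^T *m Q = 1%:M, Q *m Q^T = 1%:M,
      is_trig_mx T^T & M = Q *m col_mx T 0].

(* Reduced singular value decomposition [M = U diag(s) V^T]; when [r] is the
   smaller dimension of [M] it is the thin SVD, and when moreover [s] has
   positive entries ([r] is the rank of [M]) it is the skinny SVD. *)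
Definition is_svd m n r (M : 'M[R]_(m, n)) (U : 'M[R]_(m, r)) (s : 'rV[R]_r)
    (V : 'M[R]_(n, r)) : Prop :=
  [/\ U^T *m U = 1%:M, V^T *m V = 1%:M, forall i, 0 <= s 0 i
    & M = U *m diag_mx s *m V^T].

Definition kron_swap d n : 'M[R]_(d * n, n * d) :=
  \sum_(i < d) \sum_(j < n)
    ((delta_mx i j : 'M[R]_(d, n)) *t (delta_mx i j : 'M[R]_(d, n))^T).

End Factorizations.

(** * Real RBTLSE solutions and their relative condition number *)

Section RBTLSE.
Variable R : realType.
Variables m p n d : nat.
Implicit Types (A E : 'M[rbquat R]_(m, n)) (B F : 'M[rbquat R]_(m, d)).
Implicit Types (C : 'M[rbquat R]_(p, n)) (D : 'M[rbquat R]_(p, d)).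
Implicit Types X : 'M[R]_(n, d).

Definition rbtlse_feasible A B C D X E F : Prop :=
  (A + E) *m map_mx (@rb_real R) X = B + F /\ C *m map_mx (@rb_real R) X = D.

Definition is_real_rbtlse A B C D X : Prop :=
  exists E F, rbtlse_feasible A B C D X E F /\
    forall X' E' F', rbtlse_feasible A B C D X' E' F' ->
      rbfrob (row_mx E F) <= rbfrob (row_mx E' F').

Definition rel_errors A B C D X (eps : R) : set (\bar R) :=
  [set r | exists dA dB dC dD X',
    [/\ rbfrob (row_mx (col_mx dC dA) (col_mx dD dB))
          <= eps * rbfrob (row_mx (col_mx C A) (col_mx D B)),
        is_real_rbtlse (A + dA) (B + dB) (C + dC) (D + dD) X'
      & r = (frob (X - X') / (eps * frob X))%:E]].

(* [k] is the relative normwise condition number: the limit exists in the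
   extended reals and is the finite number [k]. *)
Definition is_rel_cond A B C D X (k : R) : Prop :=
  ereal_sup (rel_errors A B C D X eps) @[eps --> 0^'+] --> k%:E.

End RBTLSE.

(* Main.v *)
Require Import Defs.
From mathcomp Require Import all_boot all_order all_algebra.
From mathcomp Require Import ring lra.
From mathcomp Require Import all_classical all_reals all_analysis.

Set Implicit Arguments.
Unset Strict Implicit.
Unset Printing Implicit Defensive.

Import Order.TTheory GRing.Theory Num.Theory.
Import numFieldNormedType.Exports.
Local Open Scope ring_scope.

(* Stacking the four real components turns the problem into a real equality
   constrained total least squares problem for P = [A, B], S = [C, D].  With
   Y = [X; -I], the constraint reads S Y = 0 and the optimal correction is -P
   times the orthogonal projector onto the range of Y, so X is a solution iff an
   orthonormal basis Z of that range minimizes |P Z|_F over the d-frames of the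
   kernel of S.  The splitting Vs + V1 + V2 of the whole space diagonalizes this
   problem: V2 spans the minimizer, and the singular value gap gives quadratic
   growth along V1.

   For a perturbation of size t a minimizing frame exists by compactness, and the
   growth estimate puts it within O(sqrt t) of V2; normalized, it is
   V2 + Vs a + V1 b.  The equation S Y = 0 and the stationarity of |P Z|^2 give a
   linear equation for a and a Sylvester equation for b up to O((t + |b|)^2), so
   first b = O(t) and then a, b are known up to O(t^2).  Since [I, X] V2 = 0 and
   [I, X] [Vs, V1] = W1^-T, the change of X is -W1^-T [a; b] (V22 + O(t))^-1.

   The derivative only sees [dS; dP] through its products with W = [Vs, V1] and,
   after contraction by diag(Us, U1)^T, with V2; these range over all matrices
   at no cost in norm, so the norm of the derivative is the spectral norm of
   H G Z acting on the vectorizations of the two products. *)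

(** * Frobenius norm *)

Section FrobeniusNorm.
Variable R : realType.

(** The sum of [(B a_i - c b_i)^2] equals [B (A B - c^2)], which settles the case [B > 0]; if
    [B = 0], all [b_i] vanish. *)
Lemma sum_cauchy_schwarz (I : finType) (a b : I -> R) :
  (\sum_i a i * b i) ^+ 2 <= (\sum_i a i ^+ 2) * (\sum_i b i ^+ 2).
Proof.
set A := \sum_i a i ^+ 2; set B := \sum_i b i ^+ 2; set c := \sum_i a i * b i.
have B0 : 0 <= B by apply: sumr_ge0 => i _; exact: sqr_ge0.
have : 0 <= \sum_i (B * a i - c * b i) ^+ 2 by apply: sumr_ge0 => i _; exact: sqr_ge0.
have -> : \sum_i (B * a i - c * b i) ^+ 2 = B * (A * B - c ^+ 2).
  transitivity (\sum_i (B ^+ 2 * a i ^+ 2 + (- (2 * B * c)) * (a i * b i)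
      + c ^+ 2 * b i ^+ 2)); first by apply: eq_bigr => i _; ring.
  rewrite !big_split /= -!mulr_sumr -/A -/B -/c; ring.
have [B_gt0|] := ltP 0 B; first by rewrite pmulr_rge0 // subr_ge0.
move=> Ble0; have /eqP B_0 : B == 0 by rewrite eq_le Ble0.
move=> _; have b0 i : b i = 0.
  have /eqP := B_0; rewrite psumr_eq0 => [/allP /(_ i)|j _]; last exact: sqr_ge0.
  by rewrite mem_index_enum sqrf_eq0 => /(_ isT)/eqP.
by rewrite B_0 mulr0 /c big1 ?expr0n // => i _; rewrite b0 mulr0.
Qed.

Lemma frob_ge0 m n (M : 'M[R]_(m, n)) : 0 <= frob M.
Proof. exact: sqrtr_ge0. Qed.
#[local] Hint Resolve frob_ge0 : core.

Lemma frob_sq m n (M : 'M[R]_(m, n)) : frob M ^+ 2 = \sum_i \sum_j M i j ^+ 2.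
Proof.
by rewrite sqr_sqrtr // !sumr_ge0 // => i _; rewrite sumr_ge0 // => j _; rewrite sqr_ge0.
Qed.

Lemma mxtrace_mul_sum m n (A B : 'M[R]_(m, n)) :
  \tr (A^T *m B) = \sum_i \sum_j A i j * B i j.
Proof.
rewrite /mxtrace exchange_big; apply: eq_bigr => j _; rewrite mxE.
by apply: eq_bigr => i _; rewrite mxE.
Qed.

Lemma frob_tr m n (M : 'M[R]_(m, n)) : frob M ^+ 2 = \tr (M^T *m M).
Proof. by rewrite frob_sq mxtrace_mul_sum; do 2!apply: eq_bigr => ? _. Qed.

Lemma frob_le m n m' n' (A : 'M[R]_(m, n)) (B : 'M[R]_(m', n')) :
  (frob A <= frob B) = (frob A ^+ 2 <= frob B ^+ 2).
Proof. by rewrite ler_sqr ?nnegrE. Qed.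

Lemma frob_eq_sq m n m' n' (A : 'M[R]_(m, n)) (B : 'M[R]_(m', n')) :
  frob A ^+ 2 = frob B ^+ 2 -> frob A = frob B.
Proof. by move=> e; apply/le_anti; rewrite !frob_le e lexx. Qed.

Lemma frobT m n (M : 'M[R]_(m, n)) : frob M^T = frob M.
Proof.
apply: frob_eq_sq; rewrite !frob_sq exchange_big.
by do 2!apply: eq_bigr => ? _; rewrite mxE.
Qed.

Lemma frob0 m n : frob (0 : 'M[R]_(m, n)) = 0.
Proof.
by rewrite /frob big1 ?sqrtr0 // => i _; rewrite big1 // => j _; rewrite mxE expr0n.
Qed.

Lemma frob_eq0 m n (M : 'M[R]_(m, n)) : frob M = 0 -> M = 0.
Proof.
move=> M0; have /eqP : \sum_i \sum_j M i j ^+ 2 = 0 by rewrite -frob_sq M0 expr0n.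
rewrite psumr_eq0 => [/allP Mi|i _]; last by rewrite sumr_ge0 // => j _; rewrite sqr_ge0.
apply/matrixP => i j; have /(_ i (mem_index_enum i)) := Mi.
rewrite psumr_eq0 => [/allP /(_ j (mem_index_enum j))|? _]; last exact: sqr_ge0.
by rewrite sqrf_eq0 mxE => /eqP.
Qed.

Lemma frobZ m n (c : R) (M : 'M[R]_(m, n)) : frob (c *: M) = `|c| * frob M.
Proof.
rewrite /frob -sqrtr_sqr -sqrtrM ?sqr_ge0 //; congr Num.sqrt.
rewrite mulr_sumr; apply: eq_bigr => i _; rewrite mulr_sumr.
by apply: eq_bigr => j _; rewrite mxE exprMn.
Qed.

Lemma frobN m n (M : 'M[R]_(m, n)) : frob (- M) = frob M.
Proof. by rewrite -scaleN1r frobZ normrN1 mul1r. Qed.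

Lemma frob_inner m n (A B : 'M[R]_(m, n)) : \tr (A^T *m B) <= frob A * frob B.
Proof.
rewrite (le_trans (ler_norm _)) // -ler_sqr ?nnegrE ?mulr_ge0 //.
rewrite -normrX ger0_norm ?sqr_ge0 // exprMn !frob_sq mxtrace_mul_sum !pair_big /=.
exact: (sum_cauchy_schwarz (fun k => A k.1 k.2) (fun k => B k.1 k.2)).
Qed.

Lemma frobD m n (A B : 'M[R]_(m, n)) : frob (A + B) <= frob A + frob B.
Proof.
rewrite -ler_sqr ?nnegrE ?addr_ge0 // frob_tr [(A + B)^T]raddfD /= mulmxDl !mulmxDr !mxtraceD.
rewrite -!frob_tr sqrrD -[\tr (B^T *m A)]mxtrace_tr trmx_mul trmxK.
have := frob_inner A B; lra.
Qed.

Lemma frobB m n (A B : 'M[R]_(m, n)) : frob (A - B) <= frob A + frob B.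
Proof. by rewrite -(frobN B) frobD. Qed.

Lemma frobM m n r (A : 'M[R]_(m, n)) (B : 'M[R]_(n, r)) :
  frob (A *m B) <= frob A * frob B.
Proof.
rewrite -ler_sqr ?nnegrE ?mulr_ge0 // exprMn !frob_sq.
rewrite [X in _ * X]exchange_big mulr_suml; apply: ler_sum => i _.
rewrite mulr_sumr; apply: ler_sum => j _; rewrite mxE.
exact: sum_cauchy_schwarz.
Qed.

Lemma frobM_le m n r (A : 'M[R]_(m, n)) (B : 'M[R]_(n, r)) a b :
  frob A <= a -> frob B <= b -> frob (A *m B) <= a * b.
Proof. by move=> Aa Bb; rewrite (le_trans (frobM A B)) // ler_pM // frob_ge0. Qed.

Lemma frobD_le m n (A B : 'M[R]_(m, n)) a b :
  frob A <= a -> frob B <= b -> frob (A + B) <= a + b.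
Proof. by move=> Aa Bb; rewrite (le_trans (frobD A B)) // lerD. Qed.

Lemma frob_isometry m n r (Q : 'M[R]_(m, n)) (M : 'M[R]_(n, r)) :
  Q^T *m Q = 1%:M -> frob (Q *m M) = frob M.
Proof.
by move=> QQ; apply: frob_eq_sq; rewrite !frob_tr trmx_mul mulmxA -(mulmxA M^T) QQ mulmx1.
Qed.

Lemma frob_isometry_r m n r (Q : 'M[R]_(m, n)) (M : 'M[R]_(r, n)) :
  Q^T *m Q = 1%:M -> frob (M *m Q^T) = frob M.
Proof. by move=> QQ; rewrite -frobT trmx_mul trmxK frob_isometry // frobT. Qed.

(** The difference of the squares is the squared norm of the part of [M] orthogonal to the range of
    [Q]. *)
Lemma frob_bessel m n r (Q : 'M[R]_(m, n)) (M : 'M[R]_(m, r)) :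
  Q^T *m Q = 1%:M -> frob (Q^T *m M) <= frob M.
Proof.
move=> QQ; rewrite frob_le -subr_ge0.
suff -> : frob M ^+ 2 - frob (Q^T *m M) ^+ 2 = frob (M - Q *m (Q^T *m M)) ^+ 2.
  exact: sqr_ge0.
rewrite !frob_tr [(M - _)^T]raddfB /= mulmxBl !mulmxBr !raddfB /= !trmx_mul !trmxK.
rewrite !mulmxA -!(mulmxA _ Q^T Q) QQ !mulmx1.
by rewrite opprK addNr addr0.
Qed.

Lemma frob_bessel_r m n r (Q : 'M[R]_(m, n)) (M : 'M[R]_(r, m)) :
  Q^T *m Q = 1%:M -> frob (M *m Q) <= frob M.
Proof. by move=> QQ; rewrite -frobT trmx_mul -(frobT M) frob_bessel. Qed.

Lemma frob_col m1 m2 n (A : 'M[R]_(m1, n)) (B : 'M[R]_(m2, n)) :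
  frob (col_mx A B) ^+ 2 = frob A ^+ 2 + frob B ^+ 2.
Proof. by rewrite !frob_tr tr_col_mx mul_row_col mxtraceD. Qed.

Lemma frob_row m n1 n2 (A : 'M[R]_(m, n1)) (B : 'M[R]_(m, n2)) :
  frob (row_mx A B) ^+ 2 = frob A ^+ 2 + frob B ^+ 2.
Proof. by rewrite -frobT tr_row_mx frob_col !frobT. Qed.

Lemma frob_usub m1 m2 n (A : 'M[R]_(m1 + m2, n)) : frob (usubmx A) <= frob A.
Proof. by rewrite frob_le -{2}(vsubmxK A) frob_col lerDl sqr_ge0. Qed.

Lemma frob_dsub m1 m2 n (A : 'M[R]_(m1 + m2, n)) : frob (dsubmx A) <= frob A.
Proof. by rewrite frob_le -{2}(vsubmxK A) frob_col lerDr sqr_ge0. Qed.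

Lemma frob_entry m n (A : 'M[R]_(m, n)) i j : `|A i j| <= frob A.
Proof.
rewrite -ler_sqr ?nnegrE // -normrX ger0_norm ?sqr_ge0 // frob_sq.
rewrite (bigD1 i) //= (bigD1 j) //= -addrA lerDl addr_ge0 // ?sumr_ge0 // => ? _.
  exact: sqr_ge0.
by rewrite sumr_ge0 // => ? _; exact: sqr_ge0.
Qed.

End FrobeniusNorm.
#[global] Hint Resolve frob_ge0 : core.

(** * Inverses of perturbed matrices *)

Section Inverses.
Variable R : realType.

Lemma unitmx_ker n (M : 'M[R]_n) :
  (forall v : 'cV[R]_n, M *m v = 0 -> v = 0) -> M \in unitmx.
Proof.
move=> inj; rewrite -unitmx_tr -row_free_unit -kermx_eq0; apply/eqP/row_matrixP => i.
rewrite row0; apply: trmx_inj; rewrite trmx0; apply: inj.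
apply: trmx_inj; rewrite trmx_mul trmxK trmx0 -row_mul mulmx_ker.
by rewrite row0.
Qed.

(** For [|E| <= 1 / (2 (|M^-1| + 1))] the product [M^-1 E] at most halves norms, so
    [|V| <= 2 |M^-1 (M + E) V|]. With [V] a vector this gives injectivity, with [V] the inverse of
    [M + E] the bound. *)
Lemma unitmx_perturb n (M : 'M[R]_n) : M \in unitmx ->
  exists2 e, 0 < e & forall E : 'M[R]_n, frob E <= e ->
    M + E \in unitmx /\ frob (invmx (M + E)) <= 2 * frob (invmx M).
Proof.
move=> uM; set c := frob (invmx M); have c0 : 0 <= c by exact: frob_ge0.
exists (2 * (c + 1))^-1 => [|E leE]; first by rewrite invr_gt0; lra.
have small r (V : 'M[R]_(n, r)) : frob (invmx M *m E *m V) <= 2^-1 * frob V.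
  apply: frobM_le => //; apply: (le_trans (frobM_le (lexx _) leE)).
  by rewrite -/c ler_pdivrMr; lra.
have half r (V : 'M[R]_(n, r)) : frob V <= 2 * frob (invmx M *m (M + E) *m V).
  have -> : invmx M *m (M + E) *m V = V + invmx M *m E *m V.
    by rewrite mulmxDr mulVmx // mulmxDl mul1mx.
  have := frobB (V + invmx M *m E *m V) (invmx M *m E *m V).
  by rewrite addrK; have := small r V; lra.
have uME : M + E \in unitmx.
  apply: unitmx_ker => v MEv; apply: frob_eq0; apply: le_anti; rewrite frob_ge0 andbT.
  by have := half _ v; rewrite -mulmxA MEv mulmx0 frob0 mulr0.
split=> //; have := half _ (invmx (M + E)).
by rewrite -mulmxA mulmxV // mulmx1.
Qed.

End Inverses.

(** * Orthonormal frames *)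

Section OrthonormalFrames.
Variable R : realType.

(** Gram-Schmidt by induction on the number of columns: the first column is normalized to [u], the
    others are projected orthogonally to [u]. *)
Lemma orthonormalize m n (Y : 'M[R]_(m, n)) :
  (forall v : 'cV[R]_n, Y *m v = 0 -> v = 0) ->
  exists G : 'M[R]_n, (Y *m G)^T *m (Y *m G) = 1%:M.
Proof.
elim: n Y => [|n IH] Y inj.
  by exists 0; apply/matrixP => -[].
rewrite -[n.+1]/(1 + n)%N in Y inj *.
pose y := lsubmx Y; pose Y1 := rsubmx Y.
have YE : Y = row_mx y Y1 by rewrite hsubmxK.
have y0 : frob y != 0.
  apply/eqP => /frob_eq0 y0; have : col_mx (1%:M : 'M[R]_1) (0 : 'cV[R]_n) = 0.
    by apply: inj; rewrite YE mul_row_col mulmx1 mulmx0 addr0.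
  move/(congr1 usubmx); rewrite col_mxKu linear0 => /matrixP/(_ 0 0).
  by rewrite !mxE => /eqP; rewrite oner_eq0.
pose u := (frob y)^-1 *: y.
have yu : y = frob y *: u by rewrite scalerA divff ?scale1r.
have uu : u^T *m u = 1%:M.
  apply/matrixP => i j; rewrite !ord1 -trace_mx11 -frob_tr frobZ mxE eqxx.
  by rewrite ger0_norm ?invr_ge0 ?frob_ge0 // mulVf ?expr1n.
pose Y2 := Y1 - u *m (u^T *m Y1).
have uY2 : u^T *m Y2 = 0 by rewrite mulmxBr !mulmxA uu mul1mx subrr.
(* The projected columns are themselves combinations of the columns of [Y]; this transports both
   injectivity and the recursive [G] between [Y2] and [Y]. *)
have Y2E r (V : 'M[R]_(n, r)) :
    Y *m col_mx (- (frob y)^-1 *: (u^T *m Y1 *m V)) V = Y2 *m V.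
  rewrite YE mul_row_col {1}yu -scalemxAl -scalemxAr scalerA mulrN divff // scaleN1r.
  by rewrite mulmxBl -!mulmxA addrC.
have [v Y2v|G GG] := IH Y2.
  have := inj _ (etrans (Y2E _ v) Y2v) => /(congr1 dsubmx).
  by rewrite col_mxKd linear0.
exists (row_mx (col_mx (frob y)^-1%:M 0) (col_mx (- (frob y)^-1 *: (u^T *m Y1 *m G)) G)).
rewrite mul_mx_row Y2E.
have -> : Y *m col_mx (frob y)^-1%:M 0 = u.
  by rewrite YE mul_row_col mulmx0 addr0 mul_mx_scalar.
rewrite tr_row_mx mul_col_row uu GG mulmxA uY2 mul0mx trmx_mul -mulmxA.
have -> : Y2^T *m u = 0 by apply: trmx_inj; rewrite trmx_mul trmxK uY2 trmx0.
by rewrite mulmx0 [RHS]scalar_mx_block.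
Qed.

(** The argument is a row vector because compactness and the extreme value theorem are applied to
    frames flattened by [mxvec]. *)
Definition entrywise_continuous k m n (F : 'rV[R]_k -> 'M[R]_(m, n)) :=
  forall i j, continuous (fun v => F v i j).

Lemma entrywise_continuousM k m n r (F : 'rV[R]_k -> 'M[R]_(m, n))
    (G : 'rV[R]_k -> 'M[R]_(n, r)) :
  entrywise_continuous F -> entrywise_continuous G ->
  entrywise_continuous (fun v => F v *m G v).
Proof.
move=> cF cG i j.
rewrite (_ : (fun v => _) = (fun v => \sum_l F v i l * G v l j)).
  by apply: continuous_big => [|l _ v]; [exact: add_continuous|apply: continuousM;
    [exact: cF|exact: cG]].
by apply/funext => v; rewrite mxE.
Qed.

Lemma continuous_frob k m n (F : 'rV[R]_k -> 'M[R]_(m, n)) :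
  entrywise_continuous F -> continuous (fun v => frob (F v)).
Proof.
move=> cF v; apply: (@continuous_comp _ _ _ (fun v => \sum_i \sum_j F v i j ^+ 2)); last first.
  exact: sqrt_continuous.
apply: continuous_big => [|i _]; first exact: add_continuous.
apply: continuous_big => [|j _ w]; first exact: add_continuous.
by apply: continuousM; exact: cF.
Qed.

(** The orthonormal frames in the kernel of [S] form a closed bounded set, on which a continuous
    function attains its minimum. *)
Lemma exists_min_frame m N d k (P : 'M[R]_(m, N)) (S : 'M[R]_(k, N)) :
  (exists Z : 'M[R]_(N, d), Z^T *m Z = 1%:M /\ S *m Z = 0) ->
  exists Z : 'M[R]_(N, d), [/\ Z^T *m Z = 1%:M, S *m Z = 0 &
    forall Z' : 'M[R]_(N, d), Z'^T *m Z' = 1%:M -> S *m Z' = 0 ->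
      frob (P *m Z) <= frob (P *m Z')].
Proof.
move=> [Z0 [Z0o SZ0]].
pose A := [set v : 'rV[R]_(N * d) |
  (vec_mx v)^T *m (vec_mx v : 'M[R]_(N, d)) = 1%:M /\ S *m vec_mx v = 0]%classic.
have cvec : entrywise_continuous (fun v : 'rV[R]_(N * d) => vec_mx v : 'M[R]_(N, d)).
  move=> i j; rewrite (_ : (fun v => _) = (fun v : 'rV[R]_(N * d) => v 0 (mxvec_index i j))).
    exact: coord_continuous.
  by apply/funext => v; rewrite mxE.
have ccst r s (C : 'M[R]_(r, s)) : entrywise_continuous (fun _ : 'rV[R]_(N * d) => C).
  by move=> i j v; exact: cst_continuous.
have clA : closed A.
  rewrite (_ : A = (fun v => frob ((vec_mx v)^T *m (vec_mx v : 'M[R]_(N, d)) - 1%:M)) @^-1` [set 0]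
    `&` (fun v => frob (S *m (vec_mx v : 'M[R]_(N, d)))) @^-1` [set 0])%classic; last first.
    apply/seteqP; split => v /= [].
      by move=> -> ->; rewrite subrr !frob0.
    by move=> /frob_eq0/subr0_eq e1 /frob_eq0 e2; split.
  apply: closedI; apply: closed_comp => //; try exact: closed_eq.
    move=> v _; apply: continuous_frob => i j.
    rewrite (_ : (fun v => _) = (fun v => ((vec_mx v)^T *m (vec_mx v : 'M[R]_(N, d))) i j
       - (1%:M : 'M[R]_d) i j)); last by apply/funext => w; rewrite !mxE.
    move=> w; apply: continuousB; last exact: cst_continuous.
    apply: entrywise_continuousM => // i' j'.
    rewrite (_ : (fun v => _) = (fun v => (vec_mx v : 'M[R]_(N, d)) j' i')).
      exact: cvec.
    by apply/funext => ?; rewrite mxE.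
  by move=> v _; apply: continuous_frob; apply: entrywise_continuousM.
have cA : compact A.
  (* The Frobenius norm of an orthonormal [d]-frame is [sqrt d], which bounds every entry. *)
  pose c : R := Num.sqrt d%:R.
  apply: (subclosed_compact clA (rV_compact (fun _ => @segment_compact R (- c) c))) => v [vo _] i /=.
  rewrite in_itv /= -ler_norml.
  case/mxvec_indexP: i => a b; have -> : v ord0 (mxvec_index a b) = vec_mx v a b by rewrite mxE.
  rewrite (le_trans (frob_entry _ _ _)) // -ler_sqr ?nnegrE ?frob_ge0 ?sqrtr_ge0 //.
  by rewrite frob_tr vo mxtrace1 sqr_sqrtr.
have A0 : (A !=set0)%classic by exists (mxvec Z0); rewrite /A /= mxvecK.
have [|v] := @EVT_min_rV R _ (fun v => frob (P *m (vec_mx v : 'M[R]_(N, d)))) A A0 cA.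
  by apply: continuous_subspaceT; apply: continuous_frob; apply: entrywise_continuousM.
rewrite inE => -[vo Sv] vmin; exists (vec_mx v); split=> // Z' Z'o SZ'.
by have := vmin (mxvec Z'); rewrite mxvecK; apply; rewrite inE /A /= mxvecK.
Qed.

End OrthonormalFrames.

(** * Reduction to minimal frames of a real problem *)

Section MinimalFrames.
Variable R : realType.
Variables m k : nat.

Definition is_min_frame N d (P : 'M[R]_(m, N)) (S : 'M[R]_(k, N)) (Z : 'M[R]_(N, d)) :=
  [/\ Z^T *m Z = 1%:M, S *m Z = 0 &
    forall Z' : 'M[R]_(N, d), Z'^T *m Z' = 1%:M -> S *m Z' = 0 ->
      frob (P *m Z) <= frob (P *m Z')].

(** Admits competitors [Y] that are not orthonormal. If [Y G] is orthonormal, then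
    [P Y G = (P Y L^T)(Y G)] because [L^T Y = 1], and neither [L^T] nor [Y G] increases the norm. *)
Lemma min_frame_le N d (P : 'M[R]_(m, N)) (S : 'M[R]_(k, N)) (Z Y L : 'M[R]_(N, d)) :
  is_min_frame P S Z -> S *m Y = 0 -> L^T *m L = 1%:M -> L^T *m Y = 1%:M ->
  frob (P *m Z) <= frob (P *m Y).
Proof.
move=> [_ _ Zmin] SY LL LY; have [v Yv|G GG] := @orthonormalize R _ _ Y.
  by rewrite -[v]mul1mx -LY -mulmxA Yv mulmx0.
have SYG : S *m (Y *m G) = 0 by rewrite mulmxA SY mul0mx.
apply: (le_trans (Zmin _ GG SYG)).
have -> : P *m (Y *m G) = (P *m Y *m L^T) *m (Y *m G).
  by rewrite !mulmxA -(mulmxA _ _ Y) LY mulmx1.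
by rewrite (le_trans (frob_bessel_r _ GG)) // frob_isometry_r.
Qed.

Lemma min_frame_exists N d (P : 'M[R]_(m, N)) (S : 'M[R]_(k, N)) (Y L : 'M[R]_(N, d)) :
  S *m Y = 0 -> L^T *m Y = 1%:M -> exists Z : 'M[R]_(N, d), is_min_frame P S Z.
Proof.
move=> SY LY; apply: exists_min_frame; have [v Yv|G GG] := @orthonormalize R _ _ Y.
  by rewrite -[v]mul1mx -LY -mulmxA Yv mulmx0.
by exists (Y *m G); split=> //; rewrite mulmxA SY mul0mx.
Qed.

(* [Z + t W] is an admissible competitor for every real [t], so the linear term
   of the quadratic [|P (Z + t W)|^2] in [t] vanishes; take [W := w (w^T P^T P Z)]. *)
Lemma min_frame_stationary N d r (P : 'M[R]_(m, N)) (S : 'M[R]_(k, N))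
    (Z : 'M[R]_(N, d)) (w : 'M[R]_(N, r)) :
  is_min_frame P S Z -> S *m w = 0 -> Z^T *m w = 0 -> (P *m w)^T *m (P *m Z) = 0.
Proof.
move=> Zmin Sw Zw; have [Zo SZ _] := Zmin.
set B := (P *m w)^T *m (P *m Z); apply: frob_eq0; set b := frob B.
pose q := frob (P *m (w *m B)) ^+ 2.
have q0 : 0 <= q by exact: sqr_ge0.
have quad t : 0 <= 2 * t * b ^+ 2 + t ^+ 2 * q.
  have SY : S *m (Z + t *: (w *m B)) = 0.
    by rewrite mulmxDr SZ -scalemxAr mulmxA Sw mul0mx scaler0 addr0.
  have ZY : Z^T *m (Z + t *: (w *m B)) = 1%:M.
    by rewrite mulmxDr Zo -scalemxAr mulmxA Zw mul0mx scaler0 addr0.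
  have := min_frame_le Zmin SY Zo ZY; rewrite frob_le mulmxDr -scalemxAr.
  set PZ := P *m Z; set PW := P *m (w *m B).
  rewrite [X in _ <= X]frob_tr [(PZ + _)^T]raddfD /= linearZ /= mulmxDl !mulmxDr.
  rewrite -!scalemxAl -!scalemxAr scalerA !mxtraceD !mxtraceZ -!frob_tr -/q.
  rewrite -[\tr (PZ^T *m PW)]mxtrace_tr trmx_mul trmxK.
  have -> : \tr (PW^T *m PZ) = b ^+ 2.
    by rewrite /b frob_tr /PW mulmxA trmx_mul -mulmxA.
  by rewrite expr2; lra.
(* Close to the minimizer [- b^2 / q] of the quadratic, but defined also for [q = 0]; the value is
   negative unless [b = 0]. *)
have := mulr_ge0 (quad (- b ^+ 2 / (1 + q))) (sqr_ge0 (1 + q)).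
have -> : (2 * (- b ^+ 2 / (1 + q)) * b ^+ 2 + (- b ^+ 2 / (1 + q)) ^+ 2 * q) * (1 + q) ^+ 2 =
   - ((2 + q) * (b ^+ 2) ^+ 2) by field; rewrite gt_eqF //; lra.
rewrite oppr_ge0 pmulr_rle0; last by lra.
by rewrite real_exprn_even_le0 ?num_real //= sqrf_eq0 => /eqP.
Qed.

End MinimalFrames.

(** * Constrained total least squares solutions versus minimal frames *)

Section ConstrainedTLS.
Variable R : realType.

Definition tls_graph n d (X : 'M[R]_(n, d)) : 'M[R]_(n + d, d) := col_mx X (- 1%:M).

Definition is_ctls m k n d (P : 'M[R]_(m, n + d)) (S : 'M[R]_(k, n + d))
    (X : 'M[R]_(n, d)) :=
  exists E, [/\ (P + E) *m tls_graph X = 0, S *m tls_graph X = 0 &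
    forall X' E', (P + E') *m tls_graph X' = 0 -> S *m tls_graph X' = 0 ->
      frob E <= frob E'].

Lemma tls_graph_frame n d (X : 'M[R]_(n, d)) :
  exists2 G, G \in unitmx & (tls_graph X *m G)^T *m (tls_graph X *m G) = 1%:M.
Proof.
have [v|G GG] := @orthonormalize R _ _ (tls_graph X).
  rewrite mul_col_mx => /(congr1 dsubmx); rewrite col_mxKd linear0 mulNmx mul1mx.
  by move/eqP; rewrite oppr_eq0 => /eqP.
exists G => //; apply: unitmx_ker => v Gv.
by rewrite -[v]mul1mx -GG -!mulmxA Gv !mulmx0.
Qed.

Lemma frame_tls_graph n d (Z : 'M[R]_(n + d, d)) : dsubmx Z \in unitmx ->
  tls_graph (- (usubmx Z *m invmx (dsubmx Z))) = Z *m - invmx (dsubmx Z).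
Proof.
by move=> uZ; rewrite -[X in _ = X *m _](vsubmxK Z) mul_col_mx !mulmxN mulmxV.
Qed.

(** A feasible correction [E] must equal [-P] on the range of [Y], so its cost is at least the norm
    of [P] there. *)
Lemma frob_frame_le m N d (P E : 'M[R]_(m, N)) (Y : 'M[R]_(N, d)) (G : 'M[R]_d) :
  (P + E) *m Y = 0 -> (Y *m G)^T *m (Y *m G) = 1%:M -> frob (P *m (Y *m G)) <= frob E.
Proof.
move=> PEY GG; have -> : P *m (Y *m G) = - (E *m (Y *m G)).
  by apply/eqP; rewrite -addr_eq0 -mulmxDl mulmxA PEY mul0mx.
by rewrite frobN; exact: frob_bessel_r.
Qed.

(** The correction [- P Z Z^T] attains the lower bound of [frob_frame_le]; invertibility of the
    lower block of [Z] makes its range the range of some [[X; -I]]. *)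
Lemma min_frame_ctls m k n d (P : 'M[R]_(m, n + d)) (S : 'M[R]_(k, n + d))
    (Z : 'M[R]_(n + d, d)) :
  is_min_frame P S Z -> dsubmx Z \in unitmx ->
  is_ctls P S (- (usubmx Z *m invmx (dsubmx Z))).
Proof.
move=> [Zo SZ Zmin] uZ; exists (- (P *m Z *m Z^T)); rewrite frame_tls_graph //; split.
- by rewrite mulmxDl mulmxA mulNmx mulmxA -(mulmxA _ Z^T) Zo mulmx1 subrr.
- by rewrite mulmxA SZ mul0mx.
move=> X' E' PE' SX'; have [G uG GG] := tls_graph_frame X'.
rewrite frobN frob_isometry_r // (le_trans _ (frob_frame_le PE' GG)) // Zmin //.
by rewrite mulmxA SX' mul0mx.
Qed.

(** The optimal [E] costs no more than the correction [- P Z Z^T] of the known minimal frame, so the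
    orthonormalized graph of [X] is minimal too. *)
Lemma ctls_min_frame m k n d (P : 'M[R]_(m, n + d)) (S : 'M[R]_(k, n + d))
    (Z : 'M[R]_(n + d, d)) (X : 'M[R]_(n, d)) :
  is_min_frame P S Z -> dsubmx Z \in unitmx -> is_ctls P S X ->
  exists2 G, G \in unitmx & is_min_frame P S (tls_graph X *m G).
Proof.
move=> Zmin uZ [E [PE SX Emin]]; have [G uG GG] := tls_graph_frame X.
have [Zo SZ Zle] := Zmin.
exists G => //; split=> // [|Z' Z'o SZ']; first by rewrite mulmxA SX mul0mx.
apply: (le_trans (frob_frame_le PE GG)); apply: (le_trans _ (Zle _ Z'o SZ')).
have := Emin (- (usubmx Z *m invmx (dsubmx Z))) (- (P *m Z *m Z^T)).
rewrite frame_tls_graph // frobN frob_isometry_r //; apply.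
  by rewrite mulmxDl mulmxA mulNmx mulmxA -(mulmxA _ Z^T) Zo mulmx1 subrr.
by rewrite mulmxA SZ mul0mx.
Qed.

End ConstrainedTLS.

(** * Real representation of reduced biquaternion matrices *)

Section RealRepresentation.
Variable R : realType.

(** Inverse of [rbcol]: every real perturbation of the stacked matrices comes from a reduced
    biquaternion one. *)
Definition uncol m n (P : 'M[R]_(quad m, n)) : 'M[rbquat R]_(m, n) :=
  \matrix_(i, j) RBQuat (usubmx P i j) (usubmx (dsubmx P) i j)
    (usubmx (dsubmx (dsubmx P)) i j) (dsubmx (dsubmx (dsubmx P)) i j).

Lemma uncolK m n : cancel (@uncol m n) (@rbcol R m n).
Proof.
move=> P; rewrite -[RHS]vsubmxK; congr col_mx; first by apply/matrixP => i j; rewrite !mxE.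
rewrite -[RHS]vsubmxK; congr col_mx; first by apply/matrixP => i j; rewrite !mxE.
rewrite -[RHS]vsubmxK; congr col_mx; by apply/matrixP => i j; rewrite !mxE.
Qed.

Lemma rbcol_inj m n : injective (@rbcol R m n).
Proof.
move=> P Q /eq_col_mx[e0 /eq_col_mx[e1 /eq_col_mx[e2 e3]]].
apply/matrixP => i j; move/matrixP/(_ i j): e0; move/matrixP/(_ i j): e1.
move/matrixP/(_ i j): e2; move/matrixP/(_ i j): e3; rewrite !mxE.
by case: (P i j) (Q i j) => ? ? ? ? [? ? ? ?] /= -> -> -> ->.
Qed.

Lemma rbcolD m n (P Q : 'M[rbquat R]_(m, n)) : rbcol (P + Q) = rbcol P + rbcol Q.
Proof. by rewrite /rbcol !add_col_mx; do ?congr col_mx; apply/matrixP => i j; rewrite !mxE. Qed.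

Lemma rbcol_mul_real m n d (P : 'M[rbquat R]_(m, n)) (X : 'M[R]_(n, d)) :
  rbcol (P *m map_mx (@rb_real R) X) = rbcol P *m X.
Proof.
have sumE (f : rbquat R -> R) : f 0 = 0 -> {morph f : a b / a + b} ->
    (forall a x, f (a * rb_real x) = f a * x) ->
    map_mx f (P *m map_mx (@rb_real R) X) = map_mx f P *m X.
  move=> f0 fD fM; apply/matrixP => i j; rewrite !mxE (big_morph f fD f0).
  by apply: eq_bigr => l _; rewrite !mxE fM.
rewrite /rbcol !mul_col_mx; congr (col_mx _ (col_mx _ (col_mx _ _))); apply: sumE => //.
all: by move=> [a0 a1 a2 a3] x /=; ring.
Qed.

Lemma rbfrobE m n (P : 'M[rbquat R]_(m, n)) : rbfrob P = frob (rbcol P).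
Proof.
apply: (pexpIrn (_ : 0 < 2)%N); rewrite ?nnegrE ?frob_ge0 ?sqrtr_ge0 //.
rewrite !frob_col !frob_sq sqr_sqrtr; last first.
  by rewrite sumr_ge0 // => i _; rewrite sumr_ge0 // => j _; exact: sqr_ge0.
rewrite -!big_split /=; apply: eq_bigr => i _; rewrite -!big_split /=.
apply: eq_bigr => j _; rewrite !mxE sqr_sqrtr ?addr_ge0 ?sqr_ge0 //; ring.
Qed.

Lemma rbfrob_row m n d (P : 'M[rbquat R]_(m, n)) (Q : 'M[rbquat R]_(m, d)) :
  rbfrob (row_mx P Q) = frob (row_mx (rbcol P) (rbcol Q)).
Proof.
by rewrite rbfrobE; apply: frob_eq_sq; rewrite frob_row /rbcol !map_row_mx !frob_col !frob_row; ring.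
Qed.

Lemma rbfrob_block m p n d (A : 'M[rbquat R]_(m, n)) (B : 'M[rbquat R]_(m, d))
    (C : 'M[rbquat R]_(p, n)) (D : 'M[rbquat R]_(p, d)) :
  rbfrob (row_mx (col_mx C A) (col_mx D B)) =
  frob (col_mx (row_mx (rbcol C) (rbcol D)) (row_mx (rbcol A) (rbcol B))).
Proof.
rewrite rbfrobE; apply: frob_eq_sq.
by rewrite frob_col !frob_row /rbcol !map_row_mx !map_col_mx !frob_col !frob_row !frob_col; ring.
Qed.

(** [rbcol] is an additive norm-preserving bijection that commutes with real right factors, so
    feasibility and cost both carry over. *)
Lemma is_real_rbtlseE m p n d (A : 'M[rbquat R]_(m, n)) (B : 'M[rbquat R]_(m, d))
    (C : 'M[rbquat R]_(p, n)) (D : 'M[rbquat R]_(p, d)) (X : 'M[R]_(n, d)) :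
  is_real_rbtlse A B C D X <->
  is_ctls (row_mx (rbcol A) (rbcol B)) (row_mx (rbcol C) (rbcol D)) X.
Proof.
have feasE X' (E : 'M[rbquat R]_(m, n)) (F : 'M[rbquat R]_(m, d)) : rbtlse_feasible A B C D X' E F <->
    (row_mx (rbcol A) (rbcol B) + row_mx (rbcol E) (rbcol F)) *m tls_graph X' = 0 /\
    row_mx (rbcol C) (rbcol D) *m tls_graph X' = 0.
  rewrite /rbtlse_feasible /tls_graph add_row_mx !mul_row_col !mulmxN !mulmx1.
  rewrite -!rbcolD -!rbcol_mul_real; split=> [[-> ->]|[/subr0_eq e1 /subr0_eq e2]].
    by rewrite !subrr.
  by split; apply: rbcol_inj.
split=> [[E [F [feas Emin]]]|[E [PE SX Emin]]].
  have [PE SX] := (feasE _ _ _).1 feas; exists (row_mx (rbcol E) (rbcol F)).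
  split=> // X' E' PE' SX'; rewrite -rbfrob_row.
  rewrite -[E']hsubmxK -(uncolK (lsubmx E')) -(uncolK (rsubmx E')) in PE' *.
  by rewrite -rbfrob_row; apply: (Emin X'); apply/feasE.
rewrite -[E]hsubmxK -(uncolK (lsubmx E)) -(uncolK (rsubmx E)) in PE Emin.
exists (uncol (lsubmx E)), (uncol (rsubmx E)); split; first exact/feasE.
by move=> X' E' F' /feasE[PE' SX']; rewrite !rbfrob_row; exact: Emin PE' SX'.
Qed.

End RealRepresentation.

(** * Growth estimate and closeness of perturbed minimizers *)

Section Perturbation.
Variable R : realType.
Variables m k q d N : nat.
Variables (P : 'M[R]_(m, N)) (S : 'M[R]_(k, N)).
Variables (Vs : 'M[R]_(N, k)) (V1 : 'M[R]_(N, q)) (V2 : 'M[R]_(N, d)).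
Variables (B : 'M[R]_k) (U1 : 'M[R]_(m, q)) (U2 : 'M[R]_(m, d)).
Variables (s1 : 'rV[R]_q) (s2 : 'rV[R]_d) (tau gam : R).

(** [Vs] spans the row space of [S]; [V1] and [V2] split its kernel into right singular directions
    of [P]. The numbers [tau] and [tau + gam] separate the squares of the small and the large
    singular values. *)
Record tls_splitting : Prop := TLSSplitting {
  tls_VsVs : Vs^T *m Vs = 1%:M; tls_V1V1 : V1^T *m V1 = 1%:M;
  tls_V2V2 : V2^T *m V2 = 1%:M; tls_VsV1 : Vs^T *m V1 = 0;
  tls_VsV2 : Vs^T *m V2 = 0; tls_V1V2 : V1^T *m V2 = 0;
  tls_complete : Vs *m Vs^T + V1 *m V1^T + V2 *m V2^T = 1%:M;
  tls_B : B \in unitmx; tls_S : S = B *m Vs^T;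
  tls_U1U1 : U1^T *m U1 = 1%:M; tls_U2U2 : U2^T *m U2 = 1%:M;
  tls_U1U2 : U1^T *m U2 = 0;
  tls_PV1 : P *m V1 = U1 *m diag_mx s1; tls_PV2 : P *m V2 = U2 *m diag_mx s2;
  tls_tau : 0 <= tau; tls_gam : 0 < gam;
  tls_s2 : forall j, s2 0 j ^+ 2 <= tau; tls_s1 : forall i, tau + gam <= s1 0 i ^+ 2 }.

Hypothesis H : tls_splitting.

Lemma tls_V1Vs : V1^T *m Vs = 0.
Proof. by apply: trmx_inj; rewrite trmx_mul trmxK tls_VsV1 // trmx0. Qed.

Lemma tls_V2Vs : V2^T *m Vs = 0.
Proof. by apply: trmx_inj; rewrite trmx_mul trmxK tls_VsV2 // trmx0. Qed.

Lemma tls_V2V1 : V2^T *m V1 = 0.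
Proof. by apply: trmx_inj; rewrite trmx_mul trmxK tls_V1V2 // trmx0. Qed.

Lemma tls_SVs : S *m Vs = B.
Proof. by rewrite (tls_S H) -mulmxA tls_VsVs // mulmx1. Qed.

Lemma tls_SV1 : S *m V1 = 0.
Proof. by rewrite (tls_S H) -mulmxA tls_VsV1 // mulmx0. Qed.

Lemma tls_SV2 : S *m V2 = 0.
Proof. by rewrite (tls_S H) -mulmxA tls_VsV2 // mulmx0. Qed.

Lemma tls_decomp r (Z : 'M[R]_(N, r)) :
  Z = Vs *m (Vs^T *m Z) + V1 *m (V1^T *m Z) + V2 *m (V2^T *m Z).
Proof. by rewrite !mulmxA -!mulmxDl tls_complete // mul1mx. Qed.

Lemma tls_pythagoras r (Z : 'M[R]_(N, r)) :
  frob Z ^+ 2 = frob (Vs^T *m Z) ^+ 2 + frob (V1^T *m Z) ^+ 2 + frob (V2^T *m Z) ^+ 2.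
Proof.
rewrite {1}frob_tr -[Z in _ *m Z]mul1mx -(tls_complete H) !mulmxDl !mulmxDr !mxtraceD.
by rewrite !frob_tr !trmx_mul !trmxK !mulmxA.
Qed.

Lemma frob_diag_mul_sq n r (s : 'rV[R]_n) (M : 'M[R]_(n, r)) :
  frob (diag_mx s *m M) ^+ 2 = \sum_i s 0 i ^+ 2 * (\sum_j M i j ^+ 2).
Proof.
rewrite frob_sq; apply: eq_bigr => i _; rewrite mulr_sumr; apply: eq_bigr => j _.
by rewrite mul_diag_mx mxE exprMn.
Qed.

Lemma frob_diag_sq n (s : 'rV[R]_n) : frob (diag_mx s) ^+ 2 = \sum_i s 0 i ^+ 2.
Proof.
rewrite frob_sq; apply: eq_bigr => i _; rewrite (bigD1 i) //= big1 => [|j ji].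
  by rewrite !mxE eqxx addr0.
by rewrite !mxE eq_sym (negbTE ji) expr0n.
Qed.

(* [1 - |row j of V2^T Z|^2 >= 0], and these defects add up to
   [|Vs^T Z|^2 + |V1^T Z|^2]; each costs at most [tau]. *)
Lemma tls_growth (Z : 'M[R]_(N, d)) : Z^T *m Z = 1%:M ->
  gam * frob (V1^T *m Z) ^+ 2 <=
  frob (diag_mx s1 *m (V1^T *m Z)) ^+ 2 + frob (diag_mx s2 *m (V2^T *m Z)) ^+ 2
  - frob (diag_mx s2) ^+ 2 + tau * frob (Vs^T *m Z) ^+ 2.
Proof.
move=> ZZ; set b := V1^T *m Z; set c := V2^T *m Z; set a := Vs^T *m Z.
have hb : (tau + gam) * frob b ^+ 2 <= frob (diag_mx s1 *m b) ^+ 2.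
  rewrite frob_diag_mul_sq frob_sq mulr_sumr; apply: ler_sum => i _.
  by apply: ler_wpM2r; [rewrite sumr_ge0 // => j _; exact: sqr_ge0|exact: tls_s1].
have rowc j : \sum_l c j l ^+ 2 <= 1.
  have -> : \sum_l c j l ^+ 2 = frob (row j c) ^+ 2.
    by rewrite frob_sq big_ord1; apply: eq_bigr => l _; rewrite [in RHS]mxE.
  rewrite /c row_mul (le_trans (_ : _ <= frob (row j V2^T) ^+ 2)) //.
    by rewrite -frob_le frob_bessel_r.
  have -> : frob (row j V2^T) ^+ 2 = (V2^T *m V2) j j.
    rewrite frob_sq big_ord1 mxE; apply: eq_bigr => l _; rewrite !mxE; exact: expr2.
  by rewrite tls_V2V2 // mxE eqxx.
have hc : tau * (frob c ^+ 2 - d%:R) <= frob (diag_mx s2 *m c) ^+ 2 - frob (diag_mx s2) ^+ 2.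
  rewrite frob_diag_mul_sq frob_diag_sq frob_sq -sumrB.
  have -> : d%:R = \sum_(i < d) 1 :> R by rewrite sumr_const card_ord.
  rewrite -sumrB mulr_sumr; apply: ler_sum => j _.
  have := rowc j; set r := \sum_l _ => r1.
  have := mulr_ge0 (_ : 0 <= tau - s2 0 j ^+ 2) (_ : 0 <= 1 - r).
  by rewrite !subr_ge0 => /(_ (tls_s2 H j) r1); lra.
have := tls_pythagoras Z; rewrite {1}frob_tr ZZ mxtrace1 -/a -/b -/c => dE.
by rewrite dE in hc; lra.
Qed.

(** [V2] is moved into the perturbed kernel by adding [Vs a0] with [(B + dS Vs) a0 = - dS V2], hence
    [a0 = O(t)]. *)
Lemma tls_competitor : exists2 e, 0 < e & exists2 c, 0 <= c &
  forall (t : R) (dP : 'M[R]_(m, N)) (dS : 'M[R]_(k, N)),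
    0 <= t -> t <= e -> frob dP <= t -> frob dS <= t ->
  exists Y, [/\ (S + dS) *m Y = 0, V2^T *m Y = 1%:M &
    frob ((P + dP) *m Y) <= frob (diag_mx s2) + c * t].
Proof.
have [e1 e1_gt0 Binv] := unitmx_perturb (tls_B H).
exists (Num.min e1 1); first by rewrite lt_min e1_gt0 ltr01.
set be := frob (invmx B) in Binv; have be0 : 0 <= be by exact: frob_ge0.
pose c := frob P * (2 * be) + (frob V2 + 2 * be).
have c0 : 0 <= c by rewrite !addr_ge0 ?mulr_ge0 ?frob_ge0.
exists c => // t dP dS t0; rewrite le_min => /andP[te1 t1] dPt dSt.
have dSV r (V : 'M[R]_(N, r)) : V^T *m V = 1%:M -> frob (dS *m V) <= t.
  by move=> VV; exact: (le_trans (frob_bessel_r _ VV)).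
have [|uB invB] := Binv (dS *m Vs).
  by rewrite (le_trans (dSV _ _ _)) // tls_VsVs.
pose a0 := - (invmx (B + dS *m Vs) *m (dS *m V2)).
have a0t : frob a0 <= 2 * be * t.
  by rewrite frobN frobM_le // dSV // tls_V2V2.
exists (V2 + Vs *m a0); split.
- rewrite mulmxDr !mulmxDl tls_SV2 add0r !mulmxA tls_SVs -mulmxDl.
  by rewrite mulmxN mulmxA mulmxV // mul1mx subrr.
- by rewrite mulmxDr tls_V2V2 // mulmxA tls_V2Vs mul0mx addr0.
have -> : (P + dP) *m (V2 + Vs *m a0) =
    U2 *m diag_mx s2 + (P *m (Vs *m a0) + dP *m (V2 + Vs *m a0)).
  by rewrite mulmxDl mulmxDr tls_PV2 // -addrA.
have Vsa0 : frob (Vs *m a0) <= 2 * be * t by rewrite frob_isometry // tls_VsVs.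
rewrite (le_trans (frobD _ _)) // frob_isometry ?tls_U2U2 // lerD2l.
have -> : c * t = frob P * (2 * be * t) + t * (frob V2 + 2 * be * 1) by rewrite /c; ring.
apply: frobD_le; apply: frobM_le => //; apply: frobD_le => //.
by rewrite (le_trans Vsa0) // ler_wpM2l // mulr_ge0.
Qed.

(** The constraint gives [Vs^T Z = - B^-1 dS Z = O(t)]. Comparing [Z] with the competitor bounds
    [|P Z|^2] by [|P V2|^2 + O(t)], and the growth estimate turns this into [|V1^T Z|^2 = O(t)]. *)
Lemma tls_rough_bound : exists2 e, 0 < e & exists2 c, 0 <= c &
  forall (t : R) (dP : 'M[R]_(m, N)) (dS : 'M[R]_(k, N)),
    0 <= t -> t <= e -> frob dP <= t -> frob dS <= t ->
  (exists Z : 'M[R]_(N, d), is_min_frame (P + dP) (S + dS) Z) /\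
  forall Z : 'M[R]_(N, d), is_min_frame (P + dP) (S + dS) Z ->
    frob (Vs^T *m Z) <= c * t /\ frob (V1^T *m Z) ^+ 2 <= c * t.
Proof.
have [e e0 [c1 c1_ge0 Yc]] := tls_competitor.
exists (Num.min e 1); first by rewrite lt_min e0 ltr01.
set be := frob (invmx B); have be0 : 0 <= be by exact: frob_ge0.
pose c2 := c1 + frob P * be + 1; pose sg := frob (diag_mx s2).
have sg0 : 0 <= sg by exact: frob_ge0.
have c2_ge0 : 0 <= c2 by rewrite !addr_ge0 ?mulr_ge0 ?frob_ge0.
(* For [t <= 1], [(sg + c2 t)^2 - sg^2 <= (2 sg c2 + c2^2) t]; the last term is the cost
   [tau |a|^2], and [gam] is the growth rate. *)
pose c3 := (2 * sg * c2 + c2 ^+ 2 + tau * be ^+ 2) / gam.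
have gam0 := tls_gam H; have tau0 := tls_tau H.
have c3_ge0 : 0 <= c3.
  by rewrite divr_ge0 ?(ltW gam0) // !addr_ge0 ?mulr_ge0 ?sqr_ge0.
exists (be + c3); first exact: addr_ge0.
move=> t dP dS t0; rewrite le_min => /andP[te1 t1] dPt dSt.
have [Y [SY VY PY]] := Yc t dP dS t0 te1 dPt dSt.
split=> [|Z Zmin]; first exact: min_frame_exists SY VY.
have [ZZ SZ _] := Zmin.
have at' : frob (Vs^T *m Z) <= be * t.
  have -> : Vs^T *m Z = - (invmx B *m (dS *m Z)).
    move/eqP: SZ; rewrite mulmxDl (tls_S H) addr_eq0 => /eqP BZ.
    by rewrite -mulmxN -BZ -mulmxA mulKmx // tls_B.
  by rewrite frobN frobM_le // (le_trans (frob_bessel_r _ ZZ)).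
split; first by rewrite (le_trans at') // ler_wpM2r // lerDl.
have PZ := le_trans (min_frame_le Zmin SY (tls_V2V2 H) VY) PY.
set b := V1^T *m Z; set c := V2^T *m Z; set a := Vs^T *m Z in at' *.
have up : frob (U1 *m (diag_mx s1 *m b) + U2 *m (diag_mx s2 *m c)) <= sg + c2 * t.
  have -> : U1 *m (diag_mx s1 *m b) + U2 *m (diag_mx s2 *m c) =
      (P + dP) *m Z - (P *m (Vs *m a) + dP *m Z).
    have -> : (P + dP) *m Z = P *m Vs *m a + P *m V1 *m b + P *m V2 *m c + dP *m Z.
      by rewrite mulmxDl {1}(tls_decomp Z) !mulmxDr !mulmxA.
    rewrite (mulmxA U1) (mulmxA U2) -(tls_PV1 H) -(tls_PV2 H) (mulmxA P).
    set x1 := P *m Vs *m a; set x2 := P *m V1 *m b; set x3 := P *m V2 *m c.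
    by rewrite opprD addrACA subrr addr0 -(addrA x1) [x1 + _]addrC addrK.
  have -> : sg + c2 * t = sg + c1 * t + (frob P * (be * t) + t) by rewrite /c2; ring.
  apply: (le_trans (frobB _ _)); apply: lerD => //; apply: frobD_le.
    by apply: frobM_le => //; rewrite frob_isometry // tls_VsVs.
  by rewrite (le_trans (frob_bessel_r _ ZZ)).
(* The ranges of [U1] and [U2] are orthogonal, so the squared norm of the sum splits. *)
have sq : frob (diag_mx s1 *m b) ^+ 2 + frob (diag_mx s2 *m c) ^+ 2 <= (sg + c2 * t) ^+ 2.
  rewrite -(frob_isometry (diag_mx s1 *m b) (tls_U1U1 H)).
  rewrite -(frob_isometry (diag_mx s2 *m c) (tls_U2U2 H)).
  rewrite -ler_sqr ?nnegrE ?frob_ge0 ?addr_ge0 ?mulr_ge0 // in up; apply: le_trans up.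
  rewrite [leRHS]frob_tr [(_ + _)^T]raddfD /= mulmxDl !mulmxDr !mxtraceD -!frob_tr.
  set x := U1 *m _; set y := U2 *m _.
  have xy : \tr (x^T *m y) = 0.
    by rewrite /x trmx_mul mulmxA -(mulmxA _ U1^T) tls_U1U2 // mulmx0 mul0mx mxtrace0.
  by rewrite -[\tr (y^T *m x)]mxtrace_tr (trmx_mul y^T) trmxK xy; lra.
have gr := tls_growth ZZ; rewrite -/a -/b -/c -/sg in gr.
have tt : t ^+ 2 <= t by rewrite expr2 ler_piMr.
have a2 : frob a ^+ 2 <= be ^+ 2 * t.
  apply: (le_trans (_ : _ <= (be * t) ^+ 2)).
    by rewrite ler_sqr ?nnegrE ?frob_ge0 ?mulr_ge0.
  by rewrite exprMn ler_wpM2l ?sqr_ge0.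
apply: (le_trans (_ : _ <= c3 * t)); last by rewrite ler_wpM2r // lerDr.
rewrite -(ler_pM2l gam0) /c3.
have -> : gam * ((2 * sg * c2 + c2 ^+ 2 + tau * be ^+ 2) / gam * t) =
   2 * sg * (c2 * t) + c2 ^+ 2 * t + tau * (be ^+ 2 * t) by field; rewrite gt_eqF.
have := ler_wpM2l tau0 a2; have := ler_wpM2l (sqr_ge0 c2) tt.
by move: sq; rewrite sqrrD exprMn; lra.
Qed.

End Perturbation.

(** * First-order expansion *)

(* Additive identities between matrices, with products and transposes as atoms. *)
Ltac mxabel :=
  repeat match goal with
  | |- context [@mulmx ?K ?m ?n ?p ?A ?B] => move: (@mulmx K m n p A B) => ?
  end;
  repeat match goal with
  | |- context [@trmx ?K ?m ?n ?A] => move: (@trmx K m n A) => ?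
  end;
  let i := fresh in let j := fresh in
  apply/matrixP => i j; rewrite !mxE; ring.

(** * Uniform orders of magnitude *)

Section BigO.
Variables (R : realType) (T : Type) (A : T -> Prop) (h : T -> R).

(** [F = O(h^i)] with one constant on all of [A]: a condition number takes a supremum over
    perturbations, so pointwise constants would not do. *)
Definition frobO (i : nat) m n (F : T -> 'M[R]_(m, n)) :=
  exists2 c, 0 <= c & forall x, A x -> frob (F x) <= c * h x ^+ i.

Hypothesis h_bounds : forall x, A x -> 0 <= h x <= 2.

Lemma frobO_cst m n (M : 'M[R]_(m, n)) : frobO 0 (fun _ => M).
Proof. by exists (frob M) => [|x _]; rewrite ?frob_ge0 // mulr1. Qed.

Lemma frobO_eq i m n (F G : T -> 'M[R]_(m, n)) :
  frobO i F -> (forall x, A x -> F x = G x) -> frobO i G.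
Proof. by move=> [c c0 Fc] FG; exists c => // x Ax; rewrite -FG // Fc. Qed.

Lemma frobO_weaken i m n (F : T -> 'M[R]_(m, n)) : frobO i.+1 F -> frobO i F.
Proof.
move=> [c c0 Fc]; exists (c * 2) => [|x Ax]; first by rewrite mulr_ge0.
have /andP[h0 h2] := h_bounds Ax; apply: (le_trans (Fc x Ax)).
by rewrite exprS -mulrA ler_wpM2l // ler_wpM2r // exprn_ge0.
Qed.

Lemma frobOD i m n (F G : T -> 'M[R]_(m, n)) :
  frobO i F -> frobO i G -> frobO i (fun x => F x + G x).
Proof.
move=> [c c0 Fc] [c' c'0 Gc]; exists (c + c') => [|x Ax]; first exact: addr_ge0.
by rewrite mulrDl frobD_le ?Fc ?Gc.
Qed.

Lemma frobON i m n (F : T -> 'M[R]_(m, n)) : frobO i F -> frobO i (fun x => - F x).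
Proof. by move=> [c c0 Fc]; exists c => // x Ax; rewrite frobN Fc. Qed.

Lemma frobOT i m n (F : T -> 'M[R]_(m, n)) : frobO i F -> frobO i (fun x => (F x)^T).
Proof. by move=> [c c0 Fc]; exists c => // x Ax; rewrite frobT Fc. Qed.

Lemma frobOM i j m n r (F : T -> 'M[R]_(m, n)) (G : T -> 'M[R]_(n, r)) :
  frobO i F -> frobO j G -> frobO (i + j) (fun x => F x *m G x).
Proof.
move=> [c c0 Fc] [c' c'0 Gc]; exists (c * c') => [|x Ax]; first exact: mulr_ge0.
by rewrite exprD mulrACA frobM_le ?Fc ?Gc.
Qed.

Lemma frobOMl i m n r (M : 'M[R]_(m, n)) (G : T -> 'M[R]_(n, r)) :
  frobO i G -> frobO i (fun x => M *m G x).
Proof. exact: (frobOM (frobO_cst M)). Qed.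

Lemma frobOMr i m n r (F : T -> 'M[R]_(m, n)) (M : 'M[R]_(n, r)) :
  frobO i F -> frobO i (fun x => F x *m M).
Proof. by move=> F_O; rewrite -[i]addn0; apply: frobOM F_O (frobO_cst M). Qed.

End BigO.

(** Converts orders in the provisional scale [h = t + |b|] into orders in [t] once [h = O(t)] is
    known. *)
Lemma frobO_rescale (R : realType) (T : Type) (A : T -> Prop) (h t : T -> R) (c : R)
    i m n (F : T -> 'M[R]_(m, n)) : 0 <= c ->
  (forall x, A x -> 0 <= h x <= c * t x) -> frobO A h i F -> frobO A t i F.
Proof.
move=> c0 ht [c' c'0 Fc]; exists (c' * c ^+ i) => [|x Ax].
  by rewrite mulr_ge0 ?exprn_ge0.
rewrite (le_trans (Fc x Ax)) // -mulrA -exprMn ler_wpM2l //.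
have /andP[hx0 hx] := ht x Ax; apply: lerXn2r => //; rewrite ?nnegrE //.
exact: le_trans hx.
Qed.

(** * Linearized constraint and stationarity equations *)

Section FirstOrder.
Variable R : realType.
Variables m k q d N : nat.
Variables (P : 'M[R]_(m, N)) (S : 'M[R]_(k, N)).
Variables (Vs : 'M[R]_(N, k)) (V1 : 'M[R]_(N, q)) (V2 : 'M[R]_(N, d)).
Variables (B : 'M[R]_k) (U1 : 'M[R]_(m, q)) (U2 : 'M[R]_(m, d)).
Variables (s1 : 'rV[R]_q) (s2 : 'rV[R]_d) (tau gam : R).
Hypothesis H : tls_splitting P S Vs V1 V2 B U1 U2 s1 s2 tau gam.


Variables (T : Type) (A : T -> Prop) (h : T -> R).
Variables (dP : T -> 'M[R]_(m, N)) (dS : T -> 'M[R]_(k, N)).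
Variables (a : T -> 'M[R]_(k, d)) (b : T -> 'M[R]_(q, d)) (y : T -> 'M[R]_(N, d)).
Hypothesis h_bounds : forall x, A x -> 0 <= h x <= 2.
Hypotheses (dP_O : frobO A h 1 dP) (dS_O : frobO A h 1 dS).
Hypotheses (a_O : frobO A h 1 a) (b_O : frobO A h 1 b).
Hypothesis yE : forall x, y x = Vs *m a x + V1 *m b x.
Hypothesis SY : forall x, A x -> (S + dS x) *m (V2 + y x) = 0.

Lemma first_order_y : frobO A h 1 y.
Proof.
apply: frobO_eq (fun x _ => esym (yE x)).
by apply: frobOD; apply: frobOMl.
Qed.

(** Since [S V2 = 0] and [S y = B a], the constraint leaves exactly [- dS y], a product of two
    first-order terms. *)
Lemma first_order_a : frobO A h 2 (fun x => B *m a x + dS x *m V2).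
Proof.
apply: (frobO_eq (frobON (frobOM dS_O first_order_y))) => x Ax.
have Sy : S *m y x = B *m a x.
  by rewrite yE mulmxDr !mulmxA (tls_SVs H) (tls_SV1 H) mul0mx addr0.
apply/esym/eqP; rewrite -addr_eq0 -[X in _ == X](SY Ax) mulmxDl !mulmxDr (tls_SV2 H) Sy.
by apply/eqP; mxabel.
Qed.

(* [V1 + w] spans the orthogonal complement of [V2 + y] in the kernel of the
   perturbed [S]. *)
Variables (a1 : T -> 'M[R]_(k, q)) (e : T -> 'M[R]_(d, q)) (w : T -> 'M[R]_(N, q)).
Hypothesis a1_O : frobO A h 1 a1.
Hypothesis eE : forall x, e x = - ((b x)^T + (a x)^T *m a1 x).
Hypothesis wE : forall x, w x = Vs *m a1 x + V2 *m e x.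
Hypothesis Sw : forall x, A x -> (S + dS x) *m (V1 + w x) = 0.
Hypothesis stationary : forall x, A x -> forall v : 'M[R]_(N, q),
  (S + dS x) *m v = 0 -> (V2 + y x)^T *m v = 0 ->
  ((P + dP x) *m v)^T *m ((P + dP x) *m (V2 + y x)) = 0.

Lemma first_order_e : frobO A h 1 e.
Proof.
apply: frobO_eq (fun x _ => esym (eE x)); apply: frobON; apply: frobOD; first exact: frobOT.
by apply: frobO_weaken => //; exact: (frobOM (frobOT a_O) a1_O).
Qed.

Lemma first_order_w : frobO A h 1 w.
Proof.
apply: frobO_eq (fun x _ => esym (wE x)).
by apply: frobOD; apply: frobOMl => //; exact: first_order_e.
Qed.

(** The product expands to [e + b^T + a^T a1], and [e] is chosen to cancel it. *)
Lemma first_order_orth x : (V2 + y x)^T *m (V1 + w x) = 0.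
Proof.
have -> : (V2 + y x)^T = V2^T + ((a x)^T *m Vs^T + (b x)^T *m V1^T).
  by rewrite yE [LHS]raddfD /= [(Vs *m _ + _)^T]raddfD /= !trmx_mul.
rewrite wE !mulmxDl !mulmxDr.
rewrite (mulmxA V2^T Vs) (mulmxA V2^T V2) (tls_V2V1 H) (tls_V2Vs H) (tls_V2V2 H).
rewrite -!(mulmxA _ Vs^T) -!(mulmxA _ V1^T).
rewrite (mulmxA Vs^T Vs) (mulmxA Vs^T V2) (mulmxA V1^T Vs) (mulmxA V1^T V2).
rewrite (tls_VsV1 H) (tls_VsVs H) (tls_VsV2 H) (tls_V1V1 H) (tls_V1Vs H) (tls_V1V2 H).
by rewrite !(mul0mx, mul1mx, mulmx0, mulmx1) eE; mxabel.
Qed.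

Lemma first_order_a1 : frobO A h 2 (fun x => B *m a1 x + dS x *m V1).
Proof.
apply: (frobO_eq (frobON (frobOM dS_O first_order_w))) => x Ax.
have Sw' : S *m w x = B *m a1 x.
  by rewrite wE mulmxDr !mulmxA (tls_SVs H) (tls_SV2 H) mul0mx addr0.
apply/esym/eqP; rewrite -addr_eq0 -[X in _ == X](Sw Ax) mulmxDl !mulmxDr (tls_SV1 H) Sw'.
by apply/eqP; mxabel.
Qed.

(** The effective perturbation of [P] on the kernel of [S]: the second term accounts for the
    first-order motion of that kernel along [Vs]. *)
Let D x := dP x - P *m Vs *m invmx B *m dS x.

(** For [(c, V, v) = (a, V2, y)] and [(a1, V1, w)] the left side is of second order, so
    [P Vs c + dP (V + v)] agrees with [D V] up to second order. *)
Let defect r (c : 'M[R]_(k, r)) (V v : 'M[R]_(N, r)) x :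
  - (dP x *m v) - P *m Vs *m invmx B *m (B *m c + dS x *m V) =
  D x *m V - P *m Vs *m c - dP x *m (V + v).
Proof.
rewrite /D !mulmxDr mulmxDl mulNmx (mulmxA _ B) (mulmxKV (tls_B H)) (mulmxA _ (dS x) V).
mxabel.
Qed.

(** Stationarity is tested on [V1 + w]. With images [U2 diag(s2) + g] of [V2 + y] and
    [U1 diag(s1) + f] of [V1 + w], the constant term vanishes as [U1^T U2 = 0], the linear terms in
    [f] and [g] yield the Sylvester expression, and [f^T g] is quadratic. *)
Lemma first_order_b : frobO A h 2 (fun x =>
  diag_mx s1 *m diag_mx s1 *m b x - b x *m (diag_mx s2 *m diag_mx s2)
  + (diag_mx s1 *m U1^T *m (D x *m V2) + (D x *m V1)^T *m (U2 *m diag_mx s2))).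
Proof.
have y_O := first_order_y; have w_O := first_order_w; have e_O := first_order_e.
pose g x := P *m Vs *m a x + U1 *m diag_mx s1 *m b x + dP x *m (V2 + y x).
pose f x := P *m Vs *m a1 x + U2 *m diag_mx s2 *m e x + dP x *m (V1 + w x).
have Y_O : frobO A h 0 (fun x => V2 + y x).
  by apply: frobOD; [exact: frobO_cst|exact: frobO_weaken].
have w_O0 : frobO A h 0 (fun x => V1 + w x).
  by apply: frobOD; [exact: frobO_cst|exact: frobO_weaken].
have g_O : frobO A h 1 g.
  apply: frobOD; last exact: (frobOM dP_O Y_O).
  by apply: frobOD; apply: frobOMl.
have f_O : frobO A h 1 f.
  apply: frobOD; last exact: (frobOM dP_O w_O0).
  by apply: frobOD; apply: frobOMl.
pose r2 x := - (dP x *m y x) - P *m Vs *m invmx B *m (B *m a x + dS x *m V2).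
pose r1 x := - (dP x *m w x) - P *m Vs *m invmx B *m (B *m a1 x + dS x *m V1).
have r2_O : frobO A h 2 r2.
  by apply: frobOD; apply: frobON; [exact: (frobOM dP_O y_O)|apply: frobOMl; exact: first_order_a].
have r1_O : frobO A h 2 r1.
  by apply: frobOD; apply: frobON; [exact: (frobOM dP_O w_O)|apply: frobOMl; exact: first_order_a1].
(* The exact remainder: the two constraint defects, the product [a^T a1] by which [e^T] differs from
   [- b], and the quadratic term [f^T g]. *)
have rhs_O := frobOD (frobOD (frobOMl (diag_mx s1 *m U1^T) r2_O)
   (frobOMr (U2 *m diag_mx s2) (frobOT r1_O)))
  (frobOD (frobOMr (diag_mx s2 *m diag_mx s2) (frobOT (frobOM (frobOT a_O) a1_O)))
    (frobON (frobOM (frobOT f_O) g_O))).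
apply: (frobO_eq rhs_O) => x Ax.
have PY : (P + dP x) *m (V2 + y x) = U2 *m diag_mx s2 + g x.
  rewrite mulmxDl {1}yE !(mulmxDr P) (mulmxA P Vs) (mulmxA P V1) (tls_PV1 H) (tls_PV2 H) /g.
  mxabel.
have PW : (P + dP x) *m (V1 + w x) = U1 *m diag_mx s1 + f x.
  rewrite mulmxDl {1}wE !(mulmxDr P) (mulmxA P Vs) (mulmxA P V2) (tls_PV1 H) (tls_PV2 H) /f.
  mxabel.
have := stationary Ax (Sw Ax) (first_order_orth x); rewrite PY PW.
have -> : (U1 *m diag_mx s1 + f x)^T = diag_mx s1 *m U1^T + (f x)^T.
  by rewrite [LHS]raddfD /= trmx_mul tr_diag_mx.
rewrite mulmxDl (mulmxDr _ _ (g x)) (mulmxDr _ _ (g x)).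
have -> : diag_mx s1 *m U1^T *m (U2 *m diag_mx s2) = 0.
  by rewrite mulmxA -(mulmxA _ U1^T) (tls_U1U2 H) mulmx0 mul0mx.
rewrite add0r => st.
rewrite /r2 /r1 !defect -/(D x).
have -> : ((a x)^T *m a1 x)^T = - (b x + (e x)^T).
  by rewrite eE [(- _)^T]raddfN /= [(_ + _)^T]raddfD /= trmxK; mxabel.
have -> : (f x)^T *m g x = - (diag_mx s1 *m U1^T *m g x + (f x)^T *m (U2 *m diag_mx s2)).
  by apply/eqP; rewrite -addr_eq0 addrC -addrA st.
have -> : D x *m V2 - P *m Vs *m a x - dP x *m (V2 + y x) =
    D x *m V2 + U1 *m diag_mx s1 *m b x - g x by rewrite /g; mxabel.
have -> : D x *m V1 - P *m Vs *m a1 x - dP x *m (V1 + w x) =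
    D x *m V1 + U2 *m diag_mx s2 *m e x - f x by rewrite /f; mxabel.
rewrite [(_ - f x)^T]raddfD /= [(- f x)^T]raddfN /= [(D x *m V1 + _)^T]raddfD /=.
move: (g x) (f x) (D x *m V2) (D x *m V1) => G F DV2 DV1.
rewrite [(U2 *m _ *m _)^T]trmx_mul [(U2 *m _)^T]trmx_mul tr_diag_mx.
rewrite !mulmxDr !mulmxDl !mulmxN !mulNmx.
have -> : diag_mx s1 *m U1^T *m (U1 *m diag_mx s1 *m b x) = diag_mx s1 *m diag_mx s1 *m b x.
  by rewrite !mulmxA -(mulmxA _ U1^T) (tls_U1U1 H) mulmx1.
have -> : (e x)^T *m (diag_mx s2 *m U2^T) *m (U2 *m diag_mx s2) =
    (e x)^T *m (diag_mx s2 *m diag_mx s2).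
  by rewrite -!mulmxA (mulmxA U2^T) (tls_U2U2 H) mul1mx.
by rewrite mulmxDl; mxabel.
Qed.

End FirstOrder.

(** * Perturbation of the solution *)

Section SolutionPerturbation.
Variable R : realType.
Variables m k q d n : nat.
Variables (P : 'M[R]_(m, n + d)) (S : 'M[R]_(k, n + d)).
Variables (Vs : 'M[R]_(n + d, k)) (V1 : 'M[R]_(n + d, q)) (V2 : 'M[R]_(n + d, d)).
Variables (B : 'M[R]_k) (U1 : 'M[R]_(m, q)) (U2 : 'M[R]_(m, d)).
Variables (s1 : 'rV[R]_q) (s2 : 'rV[R]_d) (tau gam : R).
Hypothesis H : tls_splitting P S Vs V1 V2 B U1 U2 s1 s2 tau gam.
Hypothesis uV22 : dsubmx V2 \in unitmx.

(** [Y] need not be orthonormal: the condition depends only on its range, which permits the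
    normalization [V2^T Y = 1]. *)
Definition tls_stationary (P' : 'M[R]_(m, n + d)) (S' : 'M[R]_(k, n + d))
    (Y : 'M[R]_(n + d, d)) :=
  forall r (v : 'M[R]_(n + d, r)), S' *m v = 0 -> Y^T *m v = 0 ->
    (P' *m v)^T *m (P' *m Y) = 0.

(** By Pythagoras, small components along [Vs] and [V1] force [|v| <= 2 |V2^T Z v|]; so [V2^T Z] is
    invertible and [Y = V2 + Vs a + V1 b] inherits the rough bounds. *)
Lemma min_frame_close (rho : R) : 0 < rho ->
  exists2 e, 0 < e & exists2 c, 0 <= c &
  forall (t : R) (dP : 'M[R]_(m, n + d)) (dS : 'M[R]_(k, n + d)),
    0 <= t -> t <= e -> frob dP <= t -> frob dS <= t ->
  (exists Z : 'M[R]_(n + d, d), is_min_frame (P + dP) (S + dS) Z) /\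
  forall Z : 'M[R]_(n + d, d), is_min_frame (P + dP) (S + dS) Z ->
    let Y := Z *m invmx (V2^T *m Z) in
    [/\ V2^T *m Z \in unitmx, frob (Vs^T *m Y) <= c * t,
        frob (V1^T *m Y) ^+ 2 <= c * t, frob (V1^T *m Y) <= rho & dsubmx Z \in unitmx].
Proof.
move=> rho0; have [e0 e0_gt0 [c0 c0_ge0 rough]] := tls_rough_bound H.
have [eV eV_gt0 V22inv] := unitmx_perturb uV22.
pose I := frob (1%:M : 'M[R]_d); have I0 : 0 <= I by exact: frob_ge0.
pose c := c0 * (2 * I) + c0 * (2 * I) ^+ 2.
have cI0 : 0 <= c0 * (2 * I) by rewrite mulr_ge0 // mulr_ge0.
have cI20 : 0 <= c0 * (2 * I) ^+ 2 by rewrite mulr_ge0 // sqr_ge0.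
have c_ge0 : 0 <= c by exact: addr_ge0.
pose r := Num.min rho (eV / 2).
have r0 : 0 < r by rewrite lt_min rho0 divr_gt0.
(* The bounds serve, in turn, the rough estimate, [c0 t <= 1/4], [|b| <= r] and [|a| <= r]; as
   [r <= eV / 2], the lower block of [Y] stays within [eV] of that of [V2]. *)
pose e := Num.min (Num.min e0 (4 * (c0 + 1))^-1) (Num.min (r ^+ 2 / (c + 1)) (r / (c + 1))).
exists e.
  rewrite !lt_min e0_gt0 /= invr_gt0 !divr_gt0 ?exprn_gt0 //; lra.
exists c => // t dP dS t0; rewrite !le_min => /andP[/andP[te0 te1] /andP[te2 te3]] dPt dSt.
have [Zex rough'] := rough t dP dS t0 te0 dPt dSt; split=> // Z Zmin Y.
have [aZ bZ] := rough' Z Zmin; have [ZZ SZ _] := Zmin.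
have c0t : c0 * t <= 4^-1.
  have : t * (4 * (c0 + 1)) <= 1 by rewrite -ler_pdivlMr ?div1r //; lra.
  by lra.
have ct2 : c * t <= r ^+ 2.
  have : t * (c + 1) <= r ^+ 2 by rewrite -ler_pdivlMr //; lra.
  by lra.
have ct : c * t <= r.
  have : t * (c + 1) <= r by rewrite -ler_pdivlMr //; lra.
  by lra.
have half s (v : 'M[R]_(d, s)) : frob v <= 2 * frob (V2^T *m Z *m v).
  have pyth := tls_pythagoras H (Z *m v).
  have v2 : 0 <= frob v ^+ 2 by exact: sqr_ge0.
  rewrite frob_isometry // !mulmxA in pyth.
  have ha : frob (Vs^T *m Z *m v) ^+ 2 <= 4^-1 * frob v ^+ 2.
    have le1 : frob (Vs^T *m Z *m v) <= 4^-1 * frob v.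
      by apply: frobM_le => //; exact: le_trans c0t.
    apply: (le_trans (_ : _ <= (4^-1 * frob v) ^+ 2)).
      by rewrite ler_sqr ?nnegrE ?frob_ge0 // mulr_ge0 ?frob_ge0.
    by rewrite exprMn ler_wpM2r //; lra.
  have hb : frob (V1^T *m Z *m v) ^+ 2 <= 4^-1 * frob v ^+ 2.
    apply: (le_trans (_ : _ <= frob (V1^T *m Z) ^+ 2 * frob v ^+ 2)).
      by rewrite -exprMn ler_sqr ?nnegrE ?frob_ge0 ?mulr_ge0 ?frob_ge0 // frobM.
    by rewrite ler_wpM2r //; exact: le_trans c0t.
  rewrite -ler_sqr ?nnegrE ?frob_ge0 ?mulr_ge0 ?frob_ge0 // exprMn.
  by lra.
have uc : V2^T *m Z \in unitmx.
  apply: unitmx_ker => v cv; apply: frob_eq0; apply: le_anti; rewrite frob_ge0 andbT.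
  by have := half _ v; rewrite cv frob0 mulr0.
have cinv : frob (invmx (V2^T *m Z)) <= 2 * I.
  by have := half _ (invmx (V2^T *m Z)); rewrite mulmxV.
have aY : frob (Vs^T *m Y) <= c0 * (2 * I) * t.
  by rewrite mulmxA mulrAC frobM_le.
have bY2 : frob (V1^T *m Y) ^+ 2 <= c0 * (2 * I) ^+ 2 * t.
  apply: (le_trans (_ : _ <= (frob (V1^T *m Z) * frob (invmx (V2^T *m Z))) ^+ 2)).
    by rewrite ler_sqr ?nnegrE ?mulr_ge0 ?frob_ge0 // mulmxA frobM.
  rewrite [leLHS]exprMn [leRHS]mulrAC; apply: ler_pM; rewrite ?sqr_ge0 //.
  by rewrite ler_sqr ?nnegrE ?mulr_ge0 ?frob_ge0.
have aYc : frob (Vs^T *m Y) <= c * t.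
  by rewrite (le_trans aY) // ler_wpM2r // lerDl.
have bYc : frob (V1^T *m Y) ^+ 2 <= c * t.
  by rewrite (le_trans bY2) // ler_wpM2r // lerDr.
have bYr : frob (V1^T *m Y) <= r.
  by rewrite -ler_sqr ?nnegrE ?frob_ge0 ?(ltW r0) // (le_trans bYc).
split=> //; first by rewrite (le_trans bYr) // /r ge_min lexx.
have YE : Y = V2 + (Vs *m (Vs^T *m Y) + V1 *m (V1^T *m Y)).
  rewrite {1}(tls_decomp H Y) addrC; congr (_ + _).
  by rewrite /Y (mulmxA V2^T) mulmxV // mulmx1.
have ZE : Z = Y *m (V2^T *m Z) by rewrite mulmxKV.
have [|uY _] := V22inv (dsubmx (Vs *m (Vs^T *m Y) + V1 *m (V1^T *m Y))).
  rewrite (le_trans (frob_dsub _)) // (le_trans (frobD _ _)) //.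
  rewrite (frob_isometry _ (tls_VsVs H)) (frob_isometry _ (tls_V1V1 H)).
  have rV : r <= eV / 2 by rewrite /r ge_min lexx orbT.
  rewrite [leRHS]splitr; apply: lerD; [exact: (le_trans (le_trans aYc ct) rV)|exact: (le_trans bYr rV)].
by rewrite ZE -mul_dsub_mx unitmx_mul uc andbT YE linearD.
Qed.

(** The normalized basis [Y] depends only on the range, so it is the same for the graph of [X] and
    for its orthonormalization, which is a minimal frame. *)
Lemma ctls_close (rho : R) : 0 < rho ->
  exists2 e, 0 < e & exists2 c, 0 <= c &
  forall (t : R) (dP : 'M[R]_(m, n + d)) (dS : 'M[R]_(k, n + d)),
    0 <= t -> t <= e -> frob dP <= t -> frob dS <= t ->
  (exists X : 'M[R]_(n, d), is_ctls (P + dP) (S + dS) X) /\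
  forall X : 'M[R]_(n, d), is_ctls (P + dP) (S + dS) X ->
    let K := V2^T *m tls_graph X in let Y := tls_graph X *m invmx K in
    [/\ K \in unitmx, frob (Vs^T *m Y) <= c * t, frob (V1^T *m Y) ^+ 2 <= c * t,
      frob (V1^T *m Y) <= rho & tls_stationary (P + dP) (S + dS) Y].
Proof.
move=> /min_frame_close[e e0 [c c0 close]]; exists e => //; exists c => //.
move=> t dP dS t0 te dPt dSt; have [[Z0 Z0min] {}close] := close t dP dS t0 te dPt dSt.
have [_ _ _ _ uZ0] := close _ Z0min; split.
  by eexists; exact: min_frame_ctls Z0min uZ0.
move=> X Xsol K Y; have [G uG Zmin] := ctls_min_frame Z0min uZ0 Xsol.
set Z := tls_graph X *m G in Zmin; have [uc aY bY2 bY _] := close _ Zmin.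
have uK : K \in unitmx by move: uc; rewrite /Z mulmxA unitmx_mul => /andP[].
have YE : Z *m invmx (V2^T *m Z) = Y.
  apply: (can_inj (mulmxK uK)); rewrite mulmxKV //.
  have -> : K = V2^T *m Z *m invmx G by rewrite /Z mulmxA mulmxK.
  by rewrite mulmxA mulmxKV // /Z mulmxK.
rewrite YE in aY bY2 bY; split=> // r v Sv Yv.
have -> : (P + dP) *m Y = (P + dP) *m Z *m invmx (V2^T *m Z) by rewrite -YE mulmxA.
rewrite mulmxA (min_frame_stationary Zmin Sv) ?mul0mx //.
by rewrite -[Z](mulmxKV uc) YE trmx_mul -mulmxA Yv mulmx0.
Qed.

Let sylvester b : 'M[R]_(q, d) :=
  diag_mx s1 *m diag_mx s1 *m b - b *m (diag_mx s2 *m diag_mx s2).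

Lemma sylvester_entry (b : 'M[R]_(q, d)) i j :
  sylvester b i j = (s1 0 i ^+ 2 - s2 0 j ^+ 2) * b i j.
Proof.
have e1 : (diag_mx s1 *m diag_mx s1 *m b) i j = s1 0 i * (s1 0 i * b i j).
  by rewrite -mulmxA mul_diag_mx mxE mul_diag_mx mxE.
have e2 : (b *m (diag_mx s2 *m diag_mx s2)) i j = b i j * s2 0 j * s2 0 j.
  by rewrite mulmxA !mul_mx_diag !mxE.
rewrite /sylvester; move: e1 e2; set M1 := _ *m b; set M2 := b *m _ => e1 e2.
have -> : (M1 - M2) i j = M1 i j - M2 i j by move: (M1) (M2) => ? ?; rewrite !mxE.
by rewrite e1 e2; ring.
Qed.

(** The operator multiplies the entry [(i, j)] by [s1_i^2 - s2_j^2], which is at least [gam]. *)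
Lemma sylvester_ge (b : 'M[R]_(q, d)) :
  gam * frob b <=
  frob (diag_mx s1 *m diag_mx s1 *m b - b *m (diag_mx s2 *m diag_mx s2)).
Proof.
have gam0 := tls_gam H.
rewrite -ler_sqr ?nnegrE ?mulr_ge0 ?frob_ge0 ?(ltW gam0) // exprMn !frob_sq mulr_sumr.
apply: ler_sum => i _; rewrite mulr_sumr; apply: ler_sum => j _.
rewrite -exprMn -/(sylvester b) sylvester_entry.
rewrite !exprMn ler_wpM2r ?sqr_ge0 //.
have := tls_s1 H i; have := tls_s2 H j => h2 h1.
by rewrite ler_sqr ?nnegrE; lra.
Qed.


(** The closeness estimate at perturbation size 0 makes the components along [Vs] and [V1]
    vanish. *)
Lemma ctls_unperturbed (X : 'M[R]_(n, d)) : is_ctls P S X ->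
  tls_graph X *m invmx (V2^T *m tls_graph X) = V2 /\ V2^T *m tls_graph X \in unitmx.
Proof.
move=> Xsol; have [e e0 [c c0 close]] := ctls_close ltr01.
have [||||_ /(_ X)] := close 0 0 0; rewrite ?frob0 ?(ltW e0) ?addr0 //.
case=> // uK; rewrite mulr0 => aY bY2 _ _; split=> //.
rewrite [LHS](tls_decomp H) (mulmxA V2^T) mulmxV // mulmx1.
have -> : Vs^T *m (tls_graph X *m invmx (V2^T *m tls_graph X)) = 0.
  by apply: frob_eq0; apply: le_anti; rewrite frob_ge0 aY.
have -> : V1^T *m (tls_graph X *m invmx (V2^T *m tls_graph X)) = 0.
  apply: frob_eq0; apply/eqP; rewrite -sqrf_eq0; apply/eqP; apply: le_anti.
  by rewrite sqr_ge0 bY2.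
by rewrite !mulmx0 !add0r.
Qed.

Definition sylvester_rhs (D : 'M[R]_(m, n + d)) : 'M[R]_(q, d) :=
  diag_mx s1 *m U1^T *m (D *m V2) + (D *m V1)^T *m (U2 *m diag_mx s2).

Definition sylvester_sol (M : 'M[R]_(q, d)) : 'M[R]_(q, d) :=
  \matrix_(i, j) (M i j / (s1 0 i ^+ 2 - s2 0 j ^+ 2)).

Lemma sylvester_solE (M : 'M[R]_(q, d)) (b := sylvester_sol M) :
  diag_mx s1 *m diag_mx s1 *m b - b *m (diag_mx s2 *m diag_mx s2) = M.
Proof.
apply/matrixP => i j.
rewrite -/(sylvester b) sylvester_entry /b mxE; field; rewrite gt_eqF // subr_gt0.
apply: (le_lt_trans (tls_s2 H j)); apply: (lt_le_trans _ (tls_s1 H i)).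
by rewrite ltrDl (tls_gam H).
Qed.

(** The derivative of the solution. The inner sum is minus the first-order part of [Vs a + V1 b];
    the sign cancels against the factor [- V22^-1] that rescales [Y] to [[X; -I]]. *)
Definition ctls_diff (X : 'M[R]_(n, d)) (dP : 'M[R]_(m, n + d)) (dS : 'M[R]_(k, n + d)) :
    'M[R]_(n, d) :=
  row_mx 1%:M X *m (Vs *m (invmx B *m (dS *m V2))
    + V1 *m sylvester_sol (sylvester_rhs (dP - P *m Vs *m invmx B *m dS)))
  *m invmx (dsubmx V2).

(** A bootstrap: all expansions are first made in the scale [h = t + |b|], the Sylvester equation
    then yields [h = O(t)], and in the scale [t] the remainders become [O(t^2)]. *)
Lemma ctls_first_order (X : 'M[R]_(n, d)) : is_ctls P S X ->
  exists2 e, 0 < e & exists2 c, 0 <= c &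
  forall (dP : 'M[R]_(m, n + d)) (dS : 'M[R]_(k, n + d)), frob (col_mx dS dP) <= e ->
  (exists X' : 'M[R]_(n, d), is_ctls (P + dP) (S + dS) X') /\
  forall X' : 'M[R]_(n, d), is_ctls (P + dP) (S + dS) X' ->
    frob (X' - X - ctls_diff X dP dS) <= c * frob (col_mx dS dP) ^+ 2.
Proof.
move=> Xsol; have [YX uKX] := ctls_unperturbed Xsol.
have [e1 e1_gt0 [c1 c1_ge0 close1]] := ctls_close ltr01.
have [eB eB_gt0 Binv] := unitmx_perturb (tls_B H).
have [eV eV_gt0 Vinv] := unitmx_perturb uV22.
(* An index bundles the perturbations with a candidate solution, and [A e] keeps those of size at
   most [e] that solve the perturbed problem. *)
pose T : Type := ('M[R]_(m, n + d) * 'M[R]_(k, n + d) * 'M[R]_(n, d))%type.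
pose dP (x : T) := x.1.1; pose dS (x : T) := x.1.2; pose gr (x : T) := tls_graph x.2.
pose K x := V2^T *m gr x; pose Y x := gr x *m invmx (K x).
pose a x := Vs^T *m Y x; pose b x := V1^T *m Y x.
pose t (x : T) := frob (col_mx (dS x) (dP x)); pose h x := t x + frob (b x).
pose A (e : R) (x : T) := t x <= e /\ is_ctls (P + dP x) (S + dS x) x.2.
have t0 x : 0 <= t x by exact: frob_ge0.
have dPt x : frob (dP x) <= t x by rewrite -[dP x](col_mxKd (dS x)); exact: frob_dsub.
have dSt x : frob (dS x) <= t x by rewrite -[dS x](col_mxKu _ (dP x)); exact: frob_usub.
pose cB := frob Vs + frob V2 * c1; have cB0 : 0 <= cB.
  by rewrite addr_ge0 ?mulr_ge0 ?frob_ge0.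
pose e0 := Num.min (Num.min e1 1) (eB / (cB + 1)).
have e0_gt0 : 0 < e0 by rewrite !lt_min e1_gt0 ltr01 divr_gt0 // ltr_wpDl.
have A0P x : A e0 x -> [/\ t x <= 1, K x \in unitmx, frob (a x) <= c1 * t x,
    frob (b x) <= 1 & tls_stationary (P + dP x) (S + dS x) (Y x)].
  move=> [te sol]; move: te; rewrite !le_min => /andP[/andP[te1 t1] _].
  have [_ /(_ _ sol)[uK ax _ bx st]] := close1 _ _ _ (t0 x) te1 (dPt x) (dSt x).
  by split.
have YE x : A e0 x -> Y x = V2 + (Vs *m a x + V1 *m b x).
  move=> /A0P[_ uK _ _ _]; rewrite {1}(tls_decomp H (Y x)) addrC; congr (_ + _).
  by rewrite /Y (mulmxA V2^T) -/(K x) mulmxV // mulmx1.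

have YK x : A e0 x -> gr x = Y x *m K x by move=> /A0P[_ uK _ _ _]; rewrite mulmxKV.
have hP x : A e0 x -> 0 <= h x <= 2.
  by move=> /A0P[t1 _ _ b1 _]; rewrite addr_ge0 ?frob_ge0 //= lerD.
have th x : t x <= h x by rewrite lerDl frob_ge0.
have dP_O : frobO (A e0) h 1 dP.
  by exists 1 => // x _; rewrite mul1r expr1; exact: le_trans (th x).
have dS_O : frobO (A e0) h 1 dS.
  by exists 1 => // x _; rewrite mul1r expr1; exact: le_trans (th x).
have a_O : frobO (A e0) h 1 a.
  exists c1 => // x /A0P[_ _ ax _ _]; rewrite expr1.
  by apply: (le_trans ax); rewrite ler_wpM2l.
have b_O : frobO (A e0) h 1 b.
  by exists 1 => // x _; rewrite mul1r expr1 lerDr.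
(* Substituting [e] into [(S + dS)(V1 + w) = 0] leaves [B' a1 = - dS (V1 - V2 b^T)], which defines
   [a1]. *)
pose B' x := B + dS x *m (Vs - V2 *m (a x)^T).
have B'P x : A e0 x -> B' x \in unitmx /\ frob (invmx (B' x)) <= 2 * frob (invmx B).
  move=> Ax; apply: Binv; have [t1 _ ax _ _] := A0P x Ax.
  have tB : t x * cB <= eB.
    have [] := Ax; rewrite le_min => /andP[_]; rewrite ler_pdivlMr ?ltr_wpDl // => teB _.
    by apply: (le_trans _ teB); rewrite ler_wpM2l // lerDl.
  apply: (le_trans _ tB); apply: frobM_le => //; apply: (le_trans (frobB _ _)).
  rewrite lerD2l; apply: frobM_le => //; rewrite frobT (le_trans ax) //.
  by rewrite ler_piMr.
have B'_O : frobO (A e0) h 0 (fun x => invmx (B' x)).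
  exists (2 * frob (invmx B)) => [|x /B'P[_]]; first by rewrite mulr_ge0 ?frob_ge0.
  by rewrite mulr1.
pose y x := Vs *m a x + V1 *m b x.
have SY x : A e0 x -> (S + dS x) *m (V2 + y x) = 0.
  move=> Ax; have [_ [_ [_ sol _]]] := Ax; have [_ uK _ _ _] := A0P x Ax.
  by rewrite -YE // /Y mulmxA -/(gr x) sol mul0mx.
pose a1 x : 'M[R]_(k, q) := - (invmx (B' x) *m (dS x *m (V1 - V2 *m (b x)^T))).
have a1O : frobO (A e0) h 1 a1.
  apply: frobON; apply: (frobOM B'_O (frobOM dS_O _ : frobO (A e0) h (1 + 0) _)).
  apply: frobOD; first exact: frobO_cst.
  by apply: frobON; apply: frobOMl; apply: frobO_weaken => //; exact: frobOT.
have a1E x : A e0 x -> B' x *m a1 x + dS x *m (V1 - V2 *m (b x)^T) = 0.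
  by move=> /B'P[uB _]; rewrite mulmxN mulKVmx // addNr.
pose e x := - ((b x)^T + (a x)^T *m a1 x).
pose w x := Vs *m a1 x + V2 *m e x.
have Sw x : A e0 x -> (S + dS x) *m (V1 + w x) = 0.
  move=> Ax; rewrite -[RHS](a1E x Ax) /B' /w /e.
  move: (a1 x) (a x) (b x) (dS x) => a1x ax bx dSx.
  rewrite !(mulmxDl, mulmxDr, mulmxN, mulNmx) !mulmxA.
  by rewrite (tls_SVs H) (tls_SV1 H) (tls_SV2 H) !mul0mx; mxabel.
have stat x : A e0 x -> forall v : 'M[R]_(n + d, q),
    (S + dS x) *m v = 0 -> (V2 + y x)^T *m v = 0 ->
    ((P + dP x) *m v)^T *m ((P + dP x) *m (V2 + y x)) = 0.
  by move=> Ax v; have [_ _ _ _ st] := A0P x Ax; rewrite -YE //; exact: st.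
have aF := first_order_a H dS_O a_O b_O (fun x => erefl (y x)) SY.
have [c3 c3_ge0 bF] := first_order_b H hP dP_O dS_O a_O b_O (fun x => erefl (y x)) SY a1O
  (fun x => erefl (e x)) (fun x => erefl (w x)) Sw stat.
pose D x := dP x - P *m Vs *m invmx B *m dS x.
pose cD := 1 + frob (P *m Vs *m invmx B).
have Dt x : frob (D x) <= cD * t x.
  by rewrite mulrDl mul1r (le_trans (frobB _ _)) // lerD // frobM_le.
pose c4 := frob (diag_mx s1 *m U1^T) * (cD * frob V2) + cD * frob V1 * frob (U2 *m diag_mx s2).
have cD0 : 0 <= cD by rewrite addr_ge0 ?frob_ge0.
have c4_ge0 : 0 <= c4 by rewrite addr_ge0 ?mulr_ge0 ?frob_ge0.
have rhs_t x : frob (sylvester_rhs (D x)) <= c4 * t x.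
  have -> : c4 * t x = frob (diag_mx s1 *m U1^T) * (cD * t x * frob V2)
     + cD * t x * frob V1 * frob (U2 *m diag_mx s2) by rewrite /c4; ring.
  by apply: frobD_le; apply: frobM_le => //; rewrite ?frobT; apply: frobM_le.
have gam0 := tls_gam H.
(* With [t] and [|b|] at most [rho], the quadratic term satisfies [c3 h^2 <= (gam / 2) h] and can be
   absorbed. *)
pose rho := Num.min 1 (gam / (4 * (c3 + 1))).
have rho0 : 0 < rho by rewrite lt_min ltr01 divr_gt0 // mulr_gt0 // ltr_wpDl.
have [e2 e2_gt0 [c2 c2_ge0 close2]] := ctls_close rho0.
pose e3 := Num.min (Num.min e0 e2) rho.
(* From [gam |b| <= (gam / 2)(t + |b|) + c4 t] follows [|b| <= (1 + 2 c4 / gam) t]; adding [t] gives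
   [h <= c5 t]. *)
pose c5 := 2 + 2 * c4 / gam.
have c5_ge0 : 0 <= c5 by rewrite addr_ge0 // divr_ge0 ?mulr_ge0 // ltW.
have sub30 x : A e3 x -> A e0 x.
  by move=> [te sol]; split=> //; move: te; rewrite !le_min => /andP[/andP[]].
have ht x : A e3 x -> 0 <= h x <= c5 * t x.
  move=> Ax; have A0x := sub30 x Ax; have := bF x A0x.
  have [te sol] := Ax; move: te; rewrite le_min => /andP[te trho].
  have te2 : t x <= e2 by apply: (le_trans te); rewrite ge_min lexx orbT.
  have [_ /(_ _ sol)[_ _ _ brho _]] := close2 _ _ _ (t0 x) te2 (dPt x) (dSt x).
  rewrite -/(K x) -/(Y x) -/(b x) in brho.
  rewrite -/(D x) -/(sylvester_rhs (D x)) => bFx; apply/andP; split.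
    by rewrite addr_ge0 ?frob_ge0.
  have := sylvester_ge (b x).
  set Sb := _ - _ in bFx *; move=> gb.
  have Sbt : frob Sb <= c3 * h x ^+ 2 + c4 * t x.
    have := frobB (Sb + sylvester_rhs (D x)) (sylvester_rhs (D x)); rewrite addrK => le1.
    by apply: (le_trans le1); apply: lerD.
  have h0 : 0 <= h x by rewrite addr_ge0 ?frob_ge0.
  have h2 : c3 * h x ^+ 2 <= gam / 2 * h x.
    rewrite expr2 mulrA ler_wpM2r //.
    have hr : h x <= 2 * rho by rewrite /h mulr_natl mulr2n lerD.
    apply: (le_trans (ler_wpM2l c3_ge0 hr)).
    have : rho <= gam / (4 * (c3 + 1)) by rewrite /rho ge_min lexx orbT.
    rewrite ler_pdivlMr ?mulr_gt0 ?ltr_wpDl // => rg.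
    by move: rg rho0; move: (rho) => r; lra.
  rewrite -(ler_pM2l gam0).
  have -> : gam * (c5 * t x) = 2 * gam * t x + 2 * c4 * t x.
    by rewrite /c5; field; rewrite gt_eqF.
  move: gb Sbt h2; rewrite /h; move: (frob Sb) (frob (b x)) (t x) => Sbn bn tx.
  by lra.
have cV : 0 <= c1 + c5 by exact: addr_ge0.
pose e4 := Num.min e3 (eV / (c1 + c5 + 1)).
have e3_gt0 : 0 < e3 by rewrite lt_min rho0 andbT lt_min e0_gt0.
have e4_gt0 : 0 < e4 by rewrite lt_min e3_gt0 divr_gt0 // ltr_wpDl.
have sub43 x : A e4 x -> A e3 x.
  by move=> [te sol]; split=> //; move: te; rewrite le_min => /andP[].
have toT i r l (F : T -> 'M[R]_(r, l)) : frobO (A e0) h i F -> frobO (A e4) t i F.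
  move=> [c c0 Fc]; apply: (frobO_rescale c5_ge0 (fun x Ax => ht x (sub43 x Ax))).
  by exists c => // x Ax; apply: Fc; exact/sub30/sub43.
(* The lower block of [Y K = [X'; -I]] shows that [K] is minus the inverse of a small perturbation
   of [V22]. *)
have K_O : frobO (A e4) t 0 K.
  exists (2 * frob (invmx (dsubmx V2))) => [|x A4x]; first by rewrite mulr_ge0 ?frob_ge0.
  have A3x := sub43 x A4x; have A0x := sub30 x A3x.
  have [_ uK ax _ _] := A0P x A0x; have /andP[_ hx] := ht x A3x.
  have [|uV Vi] := Vinv (dsubmx (y x)).
    apply: (le_trans (frob_dsub _)); apply: (le_trans (frobD _ _)).
    rewrite (frob_isometry _ (tls_VsVs H)) (frob_isometry _ (tls_V1V1 H)).
    have bx : frob (b x) <= c5 * t x by apply: le_trans hx; rewrite lerDr.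
    apply: (le_trans (lerD ax bx)); rewrite -mulrDl.
    have [] := A4x; rewrite le_min => /andP[_]; rewrite ler_pdivlMr ?ltr_wpDl // => teV _.
    by apply: (le_trans _ teV); rewrite mulrC ler_wpM2l // lerDl.
  have KE : (dsubmx V2 + dsubmx (y x)) *m K x = - 1%:M.
    by rewrite -linearD mul_dsub_mx /= -YE // -YK // col_mxKd.
  have -> : K x = - invmx (dsubmx V2 + dsubmx (y x)).
    by rewrite -[LHS](mulKmx uV) KE mulmxN mulmx1.
  by rewrite frobN mulr1.
have y_O : frobO (A e4) t 1 y.
  by apply: frobOD; apply: frobOMl; apply: toT.
have yd_O : frobO (A e4) t 1 (fun x => dsubmx (y x)).
  by have [c c0 yc] := y_O; exists c => // x Ax; rewrite (le_trans (frob_dsub _)) // yc.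
have a_lin : frobO (A e4) t 2 (fun x => a x + invmx B *m (dS x *m V2)).
  apply: frobO_eq (frobOMl (invmx B) (toT _ _ _ _ aF)) _ => x _.
  by rewrite mulmxDr mulKmx ?(tls_B H).
have b_lin : frobO (A e4) t 2 (fun x => b x + sylvester_sol (sylvester_rhs (D x))).
  have [c c0 bFc] : frobO (A e4) t 2 _ := toT _ _ _ _ (ex_intro2 _ _ c3 c3_ge0 bF).
  exists (gam^-1 * c) => [|x Ax]; first by rewrite mulr_ge0 // invr_ge0 ltW.
  rewrite -mulrA mulrC ler_pdivlMr // mulrC; apply: (le_trans (sylvester_ge _)).
  apply: (le_trans _ (bFc x Ax)).
  by rewrite mulmxDr mulmxDl opprD addrACA sylvester_solE.
(* [[I, X]] kills [V2] and maps [[X'; -I]] to [X' - X], so [X' - X = J y K]. *)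
pose J := row_mx 1%:M X.
have JE x : J *m gr x = x.2 - X by rewrite mul_row_col mul1mx mulmxN mulmx1.
have JV2 : J *m V2 = 0.
  by rewrite -YX mulmxA /J mul_row_col mul1mx mulmxN mulmx1 subrr mul0mx.
have main : frobO (A e4) t 2 (fun x => x.2 - X - ctls_diff X (dP x) (dS x)).
  have r1 : frobO (A e4) t 2 (fun x => J *m (Vs *m (a x + invmx B *m (dS x *m V2))
      + V1 *m (b x + sylvester_sol (sylvester_rhs (D x)))) *m invmx (dsubmx V2)).
    by apply: frobOMr; apply: frobOMl; apply: frobOD; apply: frobOMl.
  (* The cost of replacing [K] by [- V22^-1]; [r1] is the cost of replacing [a] and [b] by their
     linear parts. *)
  have r2 : frobO (A e4) t 2 (fun x => J *m y x *m invmx (dsubmx V2) *m (dsubmx (y x) *m K x)).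
    apply: (frobOM (i := 1) (j := 1)); first by apply: frobOMr; apply: frobOMl.
    exact: (frobOM yd_O K_O).
  apply: frobO_eq (frobON (frobOD r1 r2)) _ => x A4x; have A0x := sub30 x (sub43 x A4x).
  have KE : dsubmx (y x) *m K x = - 1%:M - dsubmx V2 *m K x.
    have := YK x A0x; rewrite YE // -/(y x) mulmxDl => /(congr1 dsubmx).
    by rewrite col_mxKd linearD /= -!mul_dsub_mx => ->; rewrite addrC addKr.
  rewrite KE -JE YK // YE // -/(y x) (mulmxA J (V2 + y x)) (mulmxDr J V2) JV2 add0r.
  rewrite /ctls_diff -/J -/(D x) /y.
  move: (a x) (b x) (K x) (invmx B *m _) (sylvester_sol _) => ax bx Kx la lb.
  rewrite (mulmxDr _ (- 1%:M)) mulmxN mulmx1 mulmxN -(mulmxA _ _ (dsubmx V2 *m _)) mulKmx //.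
  by rewrite !(mulmxDr, mulmxDl); mxabel.
have [cF cF0 mainc] := main; exists e4 => //; exists cF => // dP' dS' te.
have te1 : frob (col_mx dS' dP') <= e2.
  by apply: (le_trans te); rewrite /e4 /e3 !ge_min lexx !orbT.
split=> [|X' sol]; last exact: (mainc (dP', dS', X') (conj te sol)).
by have [] := close2 _ dP' dS' (frob_ge0 _) te1 (dPt (dP', dS', X)) (dSt (dP', dS', X)).
Qed.

End SolutionPerturbation.

(** * Kronecker products and spectral norm *)

Section Kronecker.
Variable R : realType.

(* Row-major vectorization, so that [A *t B] acts by [M |-> A M B^T]. *)
Definition tvec m n (M : 'M[R]_(m, n)) : 'cV[R]_(m * n) :=
  \col_k M (mxtens_unindex k).1 (mxtens_unindex k).2.

Definition untvec m n (v : 'cV[R]_(m * n)) : 'M[R]_(m, n) :=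
  \matrix_(i, j) v (mxtens_index (i, j)) 0.

Lemma untvecK m n : cancel (@untvec m n) (@tvec m n).
Proof.
by move=> v; apply/colP => l; rewrite !mxE -surjective_pairing mxtens_unindexK.
Qed.

Lemma tvecK m n : cancel (@tvec m n) (@untvec m n).
Proof. by move=> M; apply/matrixP => i j; rewrite !mxE mxtens_indexK. Qed.

Lemma tvecD m n (M M' : 'M[R]_(m, n)) : tvec (M + M') = tvec M + tvec M'.
Proof. by apply/colP => l; rewrite !mxE. Qed.

Lemma tvecB m n (M M' : 'M[R]_(m, n)) : tvec (M - M') = tvec M - tvec M'.
Proof. by apply/colP => l; rewrite !mxE. Qed.

Lemma sum_mxtens m n (F : 'I_(m * n) -> R) :
  \sum_l F l = \sum_i \sum_j F (mxtens_index (i, j)).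
Proof.
rewrite pair_big /= (reindex (@mxtens_index m n)) /=.
  by apply: eq_bigr => -[i j] _.
by exists (@mxtens_unindex m n) => l _; [exact: mxtens_indexK|exact: mxtens_unindexK].
Qed.

Lemma frob_tvec m n (M : 'M[R]_(m, n)) : frob (tvec M) = frob M.
Proof.
apply: frob_eq_sq; rewrite !frob_sq sum_mxtens; apply: eq_bigr => i _.
by apply: eq_bigr => j _; rewrite big_ord1 mxE mxtens_indexK.
Qed.

Lemma tens_mul_tvec m n p q (A : 'M[R]_(m, n)) (B : 'M[R]_(p, q)) (M : 'M[R]_(n, q)) :
  (A *t B) *m tvec M = tvec (A *m M *m B^T).
Proof.
apply/colP => l; case: (mxtens_indexP l) => i j.
rewrite !mxE sum_mxtens mxtens_indexK /= exchange_big; apply: eq_bigr => b _.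
rewrite !mxE mulr_suml; apply: eq_bigr => a _.
by rewrite tensmxE mxE mxtens_indexK /=; ring.
Qed.

(** Each summand acts as [M |-> E_ij M E_ij = M_ji E_ij], and these add up to the transpose. *)
Lemma kron_swap_tvec d n (M : 'M[R]_(n, d)) : kron_swap R d n *m tvec M = tvec M^T.
Proof.
rewrite /kron_swap mulmx_suml [in RHS](matrix_sum_delta M^T).
have -> : forall F : 'I_d -> 'M[R]_(d, n), tvec (\sum_i F i) = \sum_i tvec (F i).
  move=> F; apply: (big_morph (@tvec d n)); first exact: tvecD.
  by apply/colP => l; rewrite !mxE.
apply: eq_bigr => i _; rewrite mulmx_suml.
have -> : forall F : 'I_n -> 'M[R]_(d, n), tvec (\sum_i F i) = \sum_i tvec (F i).
  move=> F; apply: (big_morph (@tvec d n)); first exact: tvecD.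
  by apply/colP => l; rewrite !mxE.
apply: eq_bigr => j _; rewrite tens_mul_tvec trmxK; congr tvec.
apply/matrixP => a b; rewrite !mxE (bigD1 i) //= big1 => [|c ci]; last first.
  by rewrite !mxE (negbTE ci) mulr0.
rewrite !mxE eqxx (bigD1 j) //= big1 => [|c cj]; last first.
  by rewrite !mxE (negbTE cj) andbF mul0r.
by rewrite !mxE eqxx andbT; case: (a == i); case: (b == j);
  rewrite /= ?(mulr0, mulr1, mul0r, mul1r, addr0).
Qed.

End Kronecker.

(** * Spectral norm *)

Section SpectralNorm.
Variable R : realType.
Local Open Scope classical_set_scope.

Lemma specnorm_has_sup m n (M : 'M[R]_(m, n)) :
  has_sup [set frob (M *m x) | x in [set x : 'cV[R]_n | frob x <= 1]].
Proof.
split; first by exists (frob (M *m (0 : 'cV[R]_n))), 0 => //=; rewrite frob0.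
by exists (frob M) => _ [x /= x1 <-]; rewrite -[leRHS]mulr1 frobM_le.
Qed.

Lemma specnorm_ge0 m n (M : 'M[R]_(m, n)) : 0 <= specnorm M.
Proof.
apply: (sup_upper_bound (specnorm_has_sup M)).
by exists 0; rewrite /= ?mulmx0 frob0.
Qed.

Lemma specnorm_ge m n (M : 'M[R]_(m, n)) (x : 'cV[R]_n) :
  frob (M *m x) <= specnorm M * frob x.
Proof.
have [x0|x0] := eqVneq (frob x) 0.
  by rewrite x0 mulr0 (frob_eq0 x0) mulmx0 frob0.
have xgt0 : 0 < frob x by rewrite lt_def x0 frob_ge0.
rewrite -ler_pdivrMr //; apply: (sup_upper_bound (specnorm_has_sup M)) => /=.
exists ((frob x)^-1 *: x) => /=.
  by rewrite frobZ ger0_norm ?invr_ge0 ?frob_ge0 // mulVf.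
by rewrite -scalemxAr frobZ ger0_norm ?invr_ge0 ?frob_ge0 // mulrC.
Qed.

Lemma specnorm_approx m n (M : 'M[R]_(m, n)) (eta : R) : 0 < eta ->
  exists2 x : 'cV[R]_n, frob x <= 1 & specnorm M - eta < frob (M *m x).
Proof.
by move=> /sup_adherent /(_ (specnorm_has_sup M))[_ [x /= x1 <-] lt]; exists x.
Qed.

End SpectralNorm.

(** * The condition matrix *)

Section ConditionMatrix.
Variable R : realType.
Variables m k q d : nat.
Variables (P : 'M[R]_(m, k + q + d)) (S : 'M[R]_(k, k + q + d)).
Variables (Vs : 'M[R]_(k + q + d, k)) (V1 : 'M[R]_(k + q + d, q)) (V2 : 'M[R]_(k + q + d, d)).
Variables (Us : 'M[R]_k) (s : 'rV[R]_k) (U1 : 'M[R]_(m, q)) (U2 : 'M[R]_(m, d)).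
Variables (s1 : 'rV[R]_q) (s2 : 'rV[R]_d) (tau gam : R).
Hypothesis H : tls_splitting P S Vs V1 V2 (Us *m diag_mx s) U1 U2 s1 s2 tau gam.
Hypothesis UsUs : Us^T *m Us = 1%:M.
Hypothesis s_gt0 : forall i, 0 < s 0 i.
Variable X : 'M[R]_(k + q, d).
Hypothesis XV2 : row_mx 1%:M X *m V2 = 0.

Let W1 := usubmx (row_mx Vs V1).
Let Ss := diag_mx s.
Let Sigma1 := diag_mx s1.
Let Sigma2 := diag_mx s2.
Let Sr := block_mx Ss 0 0 Sigma1.
Let N := block_mx (0 : 'M[R]_k) 0 0 (1%:M : 'M[R]_q).
(** This is [P] times the pseudoinverse of [S], as [skinny_svd_pinv] shows. *)
Let PSdag := P *m Vs *m invmx (Us *m Ss).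
Let Qr := col_mx (- PSdag^T) (1%:M : 'M[R]_m).

(** The rows of [J = [I, X]] are orthogonal to [V2], so [J^T = W (J W)^T] for [W = [Vs, V1]]; the
    upper block reads [I = W1 (J W)^T]. *)
Lemma graph_complement_mul : row_mx 1%:M X *m row_mx Vs V1 = (invmx W1)^T.
Proof.
have JE : (row_mx 1%:M X)^T = row_mx Vs V1 *m (row_mx 1%:M X *m row_mx Vs V1)^T.
  rewrite -[LHS]mul1mx -(tls_complete H) mulmxDl -(mulmxA V2) -trmx_mul XV2 trmx0 mulmx0 addr0.
  by rewrite trmx_mul (tr_row_mx Vs) (mulmxA (row_mx Vs V1)) mul_row_col.
have W1i : W1 *m (row_mx 1%:M X *m row_mx Vs V1)^T = 1%:M.
  by rewrite /W1 mul_usub_mx -JE tr_row_mx col_mxKu trmx1.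
have [uW _] := mulmx1_unit W1i.
by apply: trmx_inj; rewrite trmxK -[LHS](mulKmx uW) W1i mulmx1.
Qed.

Lemma Ss_unit : Ss \in unitmx.
Proof.
rewrite unitmxE det_diag unitfE; apply/prodf_neq0 => i _.
by rewrite gt_eqF.
Qed.

Lemma Us_unit : Us \in unitmx.
Proof. by have [] := mulmx1_unit UsUs. Qed.

Let UsUsT : Us *m Us^T = 1%:M.
Proof. exact: mulmx1C. Qed.

Lemma invmx_UsSs : invmx (Us *m Ss) = invmx Ss *m Us^T.
Proof.
have uB : Us *m Ss \in unitmx by rewrite unitmx_mul Us_unit Ss_unit.
by apply: (can_inj (mulKmx uB)); rewrite mulmxV // mulmxA mulmxK ?Ss_unit.
Qed.

Let Gram := (Sr *m Sr) *t (1%:M : 'M[R]_d) - N *t (Sigma2^T *m Sigma2).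

Lemma gram_tvec (u : 'M[R]_(k, d)) (l : 'M[R]_(q, d)) :
  Gram *m tvec (col_mx u l) =
  tvec (col_mx (Ss *m Ss *m u) (Sigma1 *m Sigma1 *m l - l *m (Sigma2 *m Sigma2))).
Proof.
rewrite mulmxBl !tens_mul_tvec -tvecB; congr tvec.
rewrite trmx1 mulmx1 trmx_mul trmxK tr_diag_mx.
rewrite -(mulmxA Sr) /Sr !mul_block_col !mul0mx !addr0 !add0r mul1mx.
by rewrite !mul_col_mx mul0mx opp_col_mx add_col_mx subr0 !mulmxA.
Qed.

(** On matrices it scales the upper block by [Ss^2] and is the Sylvester operator on the lower one;
    the first is invertible and the second is bounded below by [gam]. *)
Lemma gram_unit : Gram \in unitmx.
Proof.
apply: unitmx_ker => v; rewrite -[v]untvecK -[untvec v]vsubmxK gram_tvec.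
set u := usubmx _; set l := dsubmx _ => /(congr1 (@untvec R _ _)); rewrite tvecK.
have -> : untvec 0 = 0 :> 'M[R]_(k + q, d) by apply/matrixP => i j; rewrite !mxE.
rewrite -[RHS]col_mx0 => /eq_col_mx[Su Sl].
have -> : u = 0.
  by apply: (can_inj (mulKmx Ss_unit)); apply: (can_inj (mulKmx Ss_unit)); rewrite mulmxA Su !mulmx0.
have -> : l = 0.
  apply: frob_eq0; apply: le_anti; rewrite frob_ge0 andbT.
  by rewrite -(pmulr_rle0 _ (tls_gam H)) (le_trans (sylvester_ge H l)) // Sl frob0.
by rewrite col_mx0; apply/colP => i; rewrite !mxE.
Qed.

(** The map behind [Hr Gr Zr] before vectorization; [M1] stands for [[Vs, V1]^T [dS; dP]^T] and [M2]
    for [diag(Us, U1)^T [dS; dP] V2]. *)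
Definition condition_map (M1 : 'M[R]_(k + q, k + m)) (M2 : 'M[R]_(k + q, d)) :
    'M[R]_(k + q, d) :=
  (invmx W1)^T *m
    col_mx (invmx Ss *m usubmx M2)
      (sylvester_sol s1 s2 (dsubmx M1 *m Qr *m (U2 *m Sigma2)
         + Sigma1 *m (dsubmx M2 - U1^T *m PSdag *m Us *m usubmx M2)))
  *m invmx (dsubmx V2).

Lemma condition_matrix_tvec (M1 : 'M[R]_(k + q, k + m)) (M2 : 'M[R]_(k + q, d)) :
  ((invmx (dsubmx V2))^T *t (invmx W1)^T) *m kron_swap R d (k + q) *m
  (invmx Gram *m row_mx ((1%:M : 'M[R]_(k + q)) *t Sigma2^T) (Sr *t (1%:M : 'M[R]_d))) *m
  block_mx (N *t (U2^T *m Qr^T)) 0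
    0 (block_mx 1%:M 0 (- (U1^T *m PSdag *m Us)) 1%:M *t (1%:M : 'M[R]_d)) *m
  col_mx (tvec M1) (tvec M2) = tvec (condition_map M1 M2)^T.
Proof.
rewrite -[in LHS](vsubmxK M1) -[in LHS](vsubmxK M2) -[LHS]mulmxA mul_block_col !mul0mx addr0 add0r.
rewrite !tens_mul_tvec -[LHS]mulmxA -[X in _ *m X]mulmxA -[LHS]mulmxA.
rewrite mul_row_col !tens_mul_tvec -tvecD /Sr /N !mul_block_col.
rewrite !mul0mx !mul1mx !addr0 !add0r trmx1 !mulmx1 (trmx_mul U2^T) !trmxK.
set rhs := (col_mx _ _ *m _ *m _ + _).
set a := invmx Ss *m usubmx M2.
set b := sylvester_sol s1 s2 (dsubmx M1 *m Qr *m (U2 *m Sigma2)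
         + Sigma1 *m (dsubmx M2 - U1^T *m PSdag *m Us *m usubmx M2)).
(* The inverse of [Gram] is evaluated by exhibiting the preimage: [Ss Ss a = Ss (usubmx M2)], and
   [b] solves the Sylvester equation. *)
have -> : tvec rhs = Gram *m tvec (col_mx a b).
  rewrite gram_tvec (sylvester_solE H) /a; congr tvec; rewrite -(mulmxA Ss) mulKVmx ?Ss_unit //.
  rewrite /rhs !mul_col_mx !mul0mx add_col_mx add0r; congr col_mx.
    by rewrite mul_row_col mul0mx addr0.
  rewrite mul_row_col mul0mx add0r -(mul_col_mx _ _ U2) -/Qr !mulmxA mulNmx.
  by rewrite [_ + dsubmx M2]addrC.
rewrite mulKmx ?gram_unit // kron_swap_tvec tens_mul_tvec trmxK; congr tvec.
by rewrite /condition_map -/a -/b !trmx_mul trmxK !mulmxA.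
Qed.

Let frame (dP : 'M[R]_(m, k + q + d)) (dS : 'M[R]_(k, k + q + d)) :=
  (row_mx Vs V1)^T *m (col_mx dS dP)^T.
Let residual (dP : 'M[R]_(m, k + q + d)) (dS : 'M[R]_(k, k + q + d)) :=
  col_mx (Us^T *m (dS *m V2)) (U1^T *m (dP *m V2)).

(** The effective perturbation is [D = Qr^T [dS; dP]], so [D V1] is read off the first product;
    [D V2] is needed only as [U1^T D V2], and inserting [Us Us^T = 1] expresses it by the second. *)
Lemma ctls_diff_condition_map dP dS :
  ctls_diff P Vs V1 V2 (Us *m diag_mx s) U1 U2 s1 s2 X dP dS =
  condition_map (frame dP dS) (residual dP dS).
Proof.
rewrite /ctls_diff /condition_map -graph_complement_mul -mul_row_col mulmxA.
congr (_ *m _ *m _); congr col_mx.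
  by rewrite -/Ss invmx_UsSs col_mxKu -mulmxA.
rewrite /sylvester_rhs /residual col_mxKu col_mxKd -/Ss -/PSdag -/Sigma1 -/Sigma2.
congr (sylvester_sol _ _ _); rewrite addrC; congr (_ + _).
  congr (_ *m _); rewrite /frame tr_row_mx mul_col_mx col_mxKd -trmx_mul -[Qr]trmxK -trmx_mul.
  congr trmx; rewrite /Qr tr_col_mx mulmxA mul_row_col raddfN /= trmxK trmx1 mul1mx.
  by rewrite mulNmx addrC.
rewrite -!mulmxA -mulmxBr; congr (_ *m (_ *m _)); rewrite (mulmxA Us) UsUsT mul1mx.
by rewrite mulmxBl !mulmxA.
Qed.

(** The squared norm of [E = [dS; dP]] splits along [[Vs, V1]] and [V2], and multiplying by
    [diag(Us, U1)^T] does not increase the second part. *)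
Lemma frame_residual_le dP dS :
  frob (frame dP dS) ^+ 2 + frob (residual dP dS) ^+ 2 <= frob (col_mx dS dP) ^+ 2.
Proof.
set E := col_mx dS dP.
rewrite /residual frob_col (frob_isometry _ (_ : Us^T^T *m _ = _)) ?trmxK //.
have le2 : frob (U1^T *m (dP *m V2)) ^+ 2 <= frob (dP *m V2) ^+ 2.
  by rewrite -frob_le frob_bessel // (tls_U1U1 H).
have -> : frob E ^+ 2 = frob (frame dP dS) ^+ 2 + frob (E *m V2) ^+ 2.
  rewrite -(frobT E) (tls_pythagoras H) /frame tr_row_mx mul_col_mx frob_col.
  by congr (_ + _); rewrite -frobT trmx_mul !trmxK.
by rewrite /E mul_col_mx frob_col lerD2l lerD2l.
Qed.

(** The lift [E = M1^T [Vs, V1]^T + diag(Us, U1) M2 V2^T] has orthogonal summands of norms [|M1|]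
    and [|M2|], so restricting to the two products loses nothing. *)
Lemma frame_residual_surj (M1 : 'M[R]_(k + q, k + m)) (M2 : 'M[R]_(k + q, d)) :
  exists dP dS, [/\ frame dP dS = M1, residual dP dS = M2 &
    frob (col_mx dS dP) ^+ 2 = frob M1 ^+ 2 + frob M2 ^+ 2].
Proof.
pose W := row_mx Vs V1.
have WW : W^T *m W = 1%:M.
  rewrite /W tr_row_mx mul_col_row (tls_VsVs H) (tls_V1V1 H) (tls_VsV1 H) (tls_V1Vs H).
  by rewrite -scalar_mx_block.
have WV2 : W^T *m V2 = 0 by rewrite tr_row_mx mul_col_mx (tls_VsV2 H) (tls_V1V2 H) col_mx0.
have V2W : V2^T *m W = 0 by apply: trmx_inj; rewrite trmx_mul trmxK WV2 trmx0.
pose C := col_mx (Us *m usubmx M2) (U1 *m dsubmx M2).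
pose E := M1^T *m W^T + C *m V2^T.
have EW : E *m W = M1^T by rewrite mulmxDl -!mulmxA WW V2W mulmx1 mulmx0 addr0.
have EV2 : E *m V2 = C by rewrite mulmxDl -!mulmxA WV2 (tls_V2V2 H) mulmx1 mulmx0 add0r.
exists (dsubmx E), (usubmx E); split.
- by rewrite /frame vsubmxK -trmx_mul EW trmxK.
- rewrite /residual !mul_usub_mx !mul_dsub_mx EV2 /C col_mxKu col_mxKd !mulmxA UsUs (tls_U1U1 H).
  by rewrite !mul1mx vsubmxK.
rewrite vsubmxK -(frobT E) (tls_pythagoras H) -(frob_col (Vs^T *m _)) -mul_col_mx -tr_row_mx.
rewrite -trmx_mul EW trmxK -(frobT (V2^T *m _)) trmx_mul !trmxK EV2 /C.
by rewrite frob_col frob_isometry // frob_isometry ?(tls_U1U1 H) // -frob_col vsubmxK.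
Qed.

End ConditionMatrix.

(** * The condition number *)

Section Splitting.
Variable R : realType.

Lemma finite_gap q d (f : 'I_q -> R) (g : 'I_d -> R) :
  (forall i, 0 < f i) -> (forall i j, g j < f i) ->
  exists tau gam, [/\ 0 <= tau, 0 < gam, forall j, g j <= tau & forall i, tau + gam <= f i].
Proof.
(* The default values 0 here and 1 in the minimum below keep [tau >= 0] and [gam > 0] also for empty
   index sets. *)
move=> f0 gf; pose tau := \big[Num.max/0]_j g j.
have tauf i : tau < f i by apply: bigmax_lt.
exists tau, (\big[Num.min/1]_i (f i - tau)); split=> [||j|i].
- exact: bigmax_ge_id.
- by apply: lt_bigmin => // i _; rewrite subr_gt0.
- exact: le_bigmax.
- by rewrite -lerBrDl; exact: bigmin_le.
Qed.

(** [S] has a right inverse, so [S Sdag = 1]; symmetry of [Sdag S] puts the range of [Sdag] inside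
    that of [Vs], where [S] determines it. *)
Lemma skinny_svd_pinv k N (S : 'M[R]_(k, N)) (Us : 'M[R]_k) (s : 'rV[R]_k)
    (Vs Sdag : 'M[R]_(N, k)) :
  is_svd S Us s Vs -> (forall i, 0 < s 0 i) -> is_pinv S Sdag ->
  Sdag = Vs *m invmx (Us *m diag_mx s).
Proof.
move=> [UU VV _ SE] s0 [SS _ _ sym].
have uB : Us *m diag_mx s \in unitmx.
  by rewrite unitmx_mul (Us_unit UU) (Ss_unit s0).
set B := Us *m diag_mx s in SE uB *.
have SVB : S *m (Vs *m invmx B) = 1%:M by rewrite SE !mulmxA -(mulmxA B) VV mulmx1 mulmxV.
have SSd : S *m Sdag = 1%:M by rewrite -[LHS]mulmx1 -SVB mulmxA SS.
have VVSd : Vs *m Vs^T *m Sdag = Sdag.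
  have SdE : Sdag = S^T *m Sdag^T *m (Vs *m invmx B).
    by rewrite -trmx_mul sym -mulmxA SVB mulmx1.
  rewrite SdE SE trmx_mul trmxK !mulmxA -(mulmxA Vs) VV mulmx1; congr (_ *m _ *m _ *m _ *m _).
rewrite -VVSd -mulmxA; congr (_ *m _).
by apply: (can_inj (mulKmx uB)); rewrite mulmxV // mulmxA -SE.
Qed.

(** [Vs] and [Q1] are orthonormal bases of the same row space, so [Vs Vs^T = Q1 Q1^T] and
    [[Vs, Q2 V]] is orthogonal like [[Q1, Q2]]. *)
Lemma svd_tls_splitting m k q d (N := (k + q + d)%N) (P : 'M[R]_(m, N)) (S : 'M[R]_(k, N))
    (Q1 : 'M[R]_(N, k)) (Q2 : 'M[R]_(N, q + d)) (T : 'M[R]_k)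
    (U : 'M[R]_(m, q + d)) (sigma : 'rV[R]_(q + d)) (V : 'M[R]_(q + d))
    (Us : 'M[R]_k) (s : 'rV[R]_k) (Vs : 'M[R]_(N, k)) :
  is_qr S^T Q1 Q2 T -> is_svd (P *m Q2) U sigma V -> is_svd S Us s Vs ->
  (forall (i : 'I_q) (j : 'I_d), rsubmx sigma 0 j < lsubmx sigma 0 i) ->
  (forall i, 0 < sigma 0 i) -> (forall i, 0 < s 0 i) ->
  exists tau gam, tls_splitting P S Vs (lsubmx (Q2 *m V)) (rsubmx (Q2 *m V))
    (Us *m diag_mx s) (lsubmx U) (rsubmx U) (lsubmx sigma) (rsubmx sigma) tau gam.
Proof.
move=> [QQ QQT _ SQ] [UU VV _ PQ] [UsUs VsVs _ SE] gap sig0 s0.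
move: QQ; rewrite tr_row_mx mul_col_row [1%:M]scalar_mx_block.
case/eq_block_mx=> [Q11 Q12 Q21 Q22].
move: QQT; rewrite tr_row_mx mul_row_col => Qcomp.
have STQ : S^T = Q1 *m T by rewrite SQ mul_row_col mulmx0 addr0.
have SE' : S = T^T *m Q1^T by rewrite -trmx_mul -STQ trmxK.
have uB : Us *m diag_mx s \in unitmx by rewrite unitmx_mul (Us_unit UsUs) (Ss_unit s0).
set B := Us *m diag_mx s in SE uB *.
have [F VsE] : exists F, Vs^T = F *m Q1^T.
  exists (invmx B *m T^T).
  by apply: (can_inj (mulKmx uB)); rewrite -SE SE' !mulmxA mulmxV // mul1mx.
have FF : F^T *m F = 1%:M.
  apply: mulmx1C; rewrite -VsVs -[X in _ = _ *m X]trmxK VsE trmx_mul trmxK.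
  by rewrite !mulmxA -(mulmxA F) Q11 mulmx1.
have VsVsT : Vs *m Vs^T = Q1 *m Q1^T.
  by rewrite -[X in X *m _]trmxK VsE trmx_mul trmxK !mulmxA -(mulmxA Q1) FF mulmx1.
have VsQ2 : Vs^T *m Q2 = 0 by rewrite VsE -mulmxA Q12 mulmx0.
have VVT : V *m V^T = 1%:M by exact: mulmx1C.
pose Vc := Q2 *m V.
have VcE : Vc = row_mx (lsubmx Vc) (rsubmx Vc) by rewrite hsubmxK.
have VcVc : Vc^T *m Vc = 1%:M.
  by rewrite /Vc trmx_mul !mulmxA -(mulmxA V^T) Q22 mulmx1.
have VsVc : Vs^T *m Vc = 0 by rewrite mulmxA VsQ2 mul0mx.
have PVc : P *m Vc = U *m diag_mx sigma by rewrite mulmxA PQ -mulmxA VV mulmx1.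
have VcVcT : Vc *m Vc^T = Q2 *m Q2^T.
  by rewrite trmx_mul mulmxA -(mulmxA Q2) VVT mulmx1.
rewrite -/Vc; move: VcVc VsVc PVc VcVcT; rewrite {}VcE.
move: (lsubmx Vc) (rsubmx Vc) => V1 V2; rewrite row_mxKl row_mxKr tr_row_mx.
rewrite mul_col_row [1%:M]scalar_mx_block => /eq_block_mx[V11 V12 V21 V22].
rewrite mul_mx_row -[0]row_mx0 => /eq_row_mx[VsV1 VsV2].
rewrite mul_mx_row -[U]hsubmxK -[sigma]hsubmxK diag_mx_row mul_row_block.
rewrite !mulmx0 addr0 add0r row_mxKl row_mxKr row_mxKl row_mxKr => /eq_row_mx[PV1 PV2].
rewrite mul_row_col => VcVcT.
move: UU; rewrite -[U]hsubmxK tr_row_mx mul_col_row [1%:M]scalar_mx_block.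
case/eq_block_mx; rewrite row_mxKl row_mxKr => U11 U12 U21 U22.
have s1_gt0 i : 0 < lsubmx sigma 0 i by rewrite mxE.
have s2_gt0 i : 0 < rsubmx sigma 0 i by rewrite mxE.
have [|i j|tau [gam [tau0 gam0 s2t s1t]]] :=
    @finite_gap q d (fun i => lsubmx sigma 0 i ^+ 2) (fun j => rsubmx sigma 0 j ^+ 2).
- by move=> i; rewrite exprn_gt0.
- by rewrite ltr_sqr ?nnegrE ?(ltW (s1_gt0 _)) ?(ltW (s2_gt0 _)).
exists tau, gam; split=> //.
by rewrite VsVsT -addrA VcVcT.
Qed.

End Splitting.

(** * Limit of the suprema *)

Section Limit.
Variable R : realType.
Local Open Scope classical_set_scope.

Lemma ereal_sup_cvg_at0 (E : R -> set (\bar R)) (l c e0 : R) : 0 < e0 ->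
  (forall e, 0 < e -> e <= e0 ->
    (forall r, E e r -> (r <= (l + c * e)%:E)%E) /\
    (forall eta, 0 < eta -> exists2 r, E e r & ((l - c * e - eta)%:E <= r)%E)) ->
  ereal_sup (E e) @[e --> 0^'+] --> l%:E.
Proof.
move=> e0_gt0 EP.
have lin b : (fun e : R => (l + b * e)%:E) @ 0^'+ --> l%:E.
  apply: cvg_EFin; first exact: nearW.
  apply: cvg_at_right_filter.
  have : l + b * e @[e --> (0 : R)] --> l + b * 0.
    by apply: cvgD; [exact: cvg_cst|apply: cvgM; [exact: cvg_cst|exact: cvg_id]].
  by rewrite mulr0 addr0.
apply: (@squeeze_cvge _ _ _ _ (fun e => (l + - c * e)%:E) _ (fun e => (l + c * e)%:E)) => //.
near=> e.
have e_gt0 : 0 < e by near: e; exact: nbhs_right_gt.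
have e_le : e <= e0 by near: e; exact: nbhs_right_le.
have [Eub Eapx] := EP e e_gt0 e_le; apply/andP; split; last exact: ge_ereal_sup.
apply/lee_addgt0Pr => eta eta0; have [r Er rle] := Eapx eta eta0.
rewrite -leeBlDr // -EFinB mulNr; apply: (le_trans rle); exact: ereal_sup_ubound.
Unshelve. all: by end_near. Qed.

End Limit.

(* Here n = 4p + q: full row rank of C^R_c (4p x n) forces 4p <= n. *)
Theorem theorem5p1 (R : realType) (m p q d : nat)
  (A : 'M[rbquat R]_(m, quad p + q)) (B : 'M[rbquat R]_(m, d))
  (C : 'M[rbquat R]_(p, quad p + q)) (D : 'M[rbquat R]_(p, d))
  (Q1 : 'M[R]_(quad p + q + d, quad p)) (Q2 : 'M[R]_(quad p + q + d, q + d))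
  (T : 'M[R]_(quad p))
  (U : 'M[R]_(quad m, q + d)) (sigma : 'rV[R]_(q + d)) (V : 'M[R]_(q + d))
  (Us : 'M[R]_(quad p)) (s : 'rV[R]_(quad p))
  (Vs : 'M[R]_(quad p + q + d, quad p))
  (Sdag : 'M[R]_(quad p + q + d, quad p))
  (X : 'M[R]_(quad p + q, d)) :
  let P := row_mx (rbcol A) (rbcol B) in
  let S := row_mx (rbcol C) (rbcol D) in
  let U1 := lsubmx U in
  let U2 := rsubmx U in
  let sigma1 := lsubmx sigma in
  let sigma2 := rsubmx sigma in
  let Sigma1 := diag_mx sigma1 in
  let Sigma2 := diag_mx sigma2 in
  let Vc := Q2 *m V in
  let Vc1 := lsubmx Vc in
  let Vc22 := drsubmx Vc in
  let Ss := diag_mx s in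
  let Qr := col_mx (- (P *m Sdag)^T) (1%:M : 'M[R]_(quad m)) in
  let Sr := block_mx Ss 0 0 Sigma1 in
  let W1 := usubmx (row_mx Vs Vc1) in
  let N := block_mx (0 : 'M[R]_(quad p)) 0 0 (1%:M : 'M[R]_q) in
  let Hr := ((invmx Vc22)^T *t (invmx W1)^T) *m kron_swap R d (quad p + q) in
  let Gr :=
    invmx ((Sr *m Sr) *t (1%:M : 'M[R]_d) - N *t (Sigma2^T *m Sigma2))
      *m row_mx ((1%:M : 'M[R]_(quad p + q)) *t Sigma2^T)
                (Sr *t (1%:M : 'M[R]_d)) in
  let Zr :=
    block_mx
      (N *t (U2^T *m Qr^T)) 0
      0 (block_mx 1%:M 0 (- (U1^T *m (P *m Sdag) *m Us)) 1%:M
           *t (1%:M : 'M[R]_d)) in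
  (quad p + q + d <= m)%N ->
  row_free (rbcol C) ->
  is_qr S^T Q1 Q2 T ->
  is_svd (P *m Q2) U sigma V ->
  (forall i j : 'I_(q + d), (i <= j)%N -> sigma 0 j <= sigma 0 i) ->
  (forall (i : 'I_q) (j : 'I_d), sigma2 0 j < sigma1 0 i) ->
  (forall i, 0 < sigma 0 i) ->
  Vc22 \in unitmx ->
  is_svd S Us s Vs -> (forall i, 0 < s 0 i) ->
  is_pinv S Sdag ->
  is_real_rbtlse A B C D X ->
  X != 0 ->
  is_rel_cond A B C D X
    (specnorm (Hr *m Gr *m Zr)
       * (frob (row_mx (col_mx (rbcol C) (rbcol A))
                       (col_mx (rbcol D) (rbcol B))) / frob X)).

Proof.
move=> P S U1 U2 sigma1 sigma2 Sigma1 Sigma2 Vc Vc1 Vc22 Ss Qr Sr W1 N Hr Gr Zr.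
move=> _ _ QR svdP _ gap sigma0 uVc22 svdS s0 Spinv Xsol X0.
have [tau [gam H]] := svd_tls_splitting QR svdP svdS gap sigma0 s0.
have UsUs : Us^T *m Us = 1%:M by case: svdS.
have Vc22E : Vc22 = dsubmx (rsubmx Vc) by apply/matrixP => i j; rewrite !mxE.
have uV22 : dsubmx (rsubmx Vc) \in unitmx by rewrite -Vc22E.
move/is_real_rbtlseE: Xsol => Xsol; rewrite -/P -/S in Xsol.
have [YX _] := ctls_unperturbed H uV22 Xsol.
have XV2 : row_mx 1%:M X *m rsubmx Vc = 0.
  by rewrite -[rsubmx Vc]YX mulmxA mul_row_col mul1mx mulmxN mulmx1 subrr mul0mx.
have PSdagE : P *m Sdag = P *m Vs *m invmx (Us *m Ss).
  by rewrite (skinny_svd_pinv svdS s0 Spinv) mulmxA.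
set kappa := specnorm _; set nu := frob (row_mx _ _).
pose diff := ctls_diff P Vs Vc1 (rsubmx Vc) (Us *m Ss) U1 U2 sigma1 sigma2 X.
have diff_frob M1 M2 dP dS :
    (row_mx Vs Vc1)^T *m (col_mx dS dP)^T = M1 ->
    col_mx (Us^T *m (dS *m rsubmx Vc)) (U1^T *m (dP *m rsubmx Vc)) = M2 ->
    frob (diff dP dS) = frob (Hr *m Gr *m Zr *m col_mx (tvec M1) (tvec M2)).
  move=> <- <-; rewrite /diff (ctls_diff_condition_map H UsUs s0 XV2) -frobT -frob_tvec.
  rewrite -(condition_matrix_tvec H s0).
  by rewrite /Hr /Gr /Zr Vc22E /Qr PSdagE.
have frob_tvec2 r1 r2 r3 (M1 : 'M[R]_(r1, r2)) (M2 : 'M[R]_(r1, r3)) :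
    frob (col_mx (tvec M1) (tvec M2)) ^+ 2 = frob M1 ^+ 2 + frob M2 ^+ 2.
  by rewrite frob_col !frob_tvec.
have kappa0 : 0 <= kappa by exact: specnorm_ge0.
have diff_le dP dS : frob (diff dP dS) <= kappa * frob (col_mx dS dP).
  rewrite (diff_frob _ _ _ _ erefl erefl) (le_trans (specnorm_ge _ _)) // ler_wpM2l //.
  by rewrite frob_le frob_tvec2 (frame_residual_le H UsUs).
(* A vector nearly attaining the spectral norm is scaled by [t], cut into two matrices and lifted to
   a perturbation of the same norm. *)
have diff_approx eta t : 0 < eta -> 0 <= t -> exists dP dS,
    frob (col_mx dS dP) <= t /\ t * (kappa - eta) <= frob (diff dP dS).
  move=> eta0 t0; have [x x1 xk] := specnorm_approx (Hr *m Gr *m Zr) eta0.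
  pose M1 := untvec (usubmx (t *: x)); pose M2 := untvec (dsubmx (t *: x)).
  have xE : col_mx (tvec M1) (tvec M2) = t *: x by rewrite !untvecK vsubmxK.
  have [dP [dS [e1 e2 en]]] := frame_residual_surj H UsUs M1 M2.
  exists dP, dS; rewrite (diff_frob _ _ _ _ e1 e2) xE; split.
    have -> : frob (col_mx dS dP) = frob (t *: x).
      by apply: frob_eq_sq; rewrite en -frob_tvec2 xE.
    by rewrite frobZ ger0_norm // ler_piMr.
  by rewrite -scalemxAr frobZ ger0_norm // ler_wpM2l // ltW.
have [e1 e1_gt0 [c c0 first_order]] := ctls_first_order H uV22 Xsol.
have nu0 : 0 <= nu by exact: frob_ge0.
have Xgt0 : 0 < frob X by rewrite lt_def frob_ge0 andbT; apply: contraNneq X0 => /frob_eq0 ->.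
have nuE : rbfrob (row_mx (col_mx C A) (col_mx D B)) = nu.
  by rewrite rbfrob_block; apply: frob_eq_sq; rewrite frob_col !frob_row !frob_col; ring.
(* The slope is the remainder [c (e nu)^2] divided by [e |X|] and by [e]; the radius gives
   [e nu <= e1], with [nu + 1] to avoid dividing by 0. *)
apply: (@ereal_sup_cvg_at0 _ _ _ (c * nu ^+ 2 / frob X) (e1 / (nu + 1))).
  by rewrite divr_gt0 // ltr_wpDl.
move=> e e_gt0; rewrite ler_pdivlMr ?ltr_wpDl // => e_le.
have enu : e * nu <= e1 by apply: le_trans e_le; rewrite ler_wpM2l ?(ltW e_gt0) // lerDl.
have enu0 : 0 <= e * nu by rewrite mulr_ge0 // ltW.
split.
  move=> _ [dA [dB [dC [dD [X' [le_dist /is_real_rbtlseE X'sol ->]]]]]].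
  rewrite nuE rbfrob_block in le_dist; rewrite lee_fin.
  pose dP := row_mx (rbcol dA) (rbcol dB); pose dS := row_mx (rbcol dC) (rbcol dD).
  rewrite !rbcolD -!add_row_mx -/P -/S -/dP -/dS in X'sol le_dist.
  have [_ /(_ _ X'sol)fo] := first_order dP dS (le_trans le_dist enu).
  rewrite ler_pdivrMr ?mulr_gt0 //.
  have -> : (kappa * (nu / frob X) + c * nu ^+ 2 / frob X * e) * (e * frob X) =
      kappa * (e * nu) + c * (e * nu) ^+ 2 by field; rewrite gt_eqF.
  have -> : X - X' = - ((X' - X - diff dP dS) + diff dP dS) by rewrite subrK opprB.
  rewrite frobN addrC; apply: frobD_le.
    by rewrite (le_trans (diff_le _ _)) // ler_wpM2l.
  rewrite (le_trans fo) // ler_wpM2l // ler_sqr ?nnegrE ?frob_ge0 //.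
(* Chosen so that the loss [e nu eta'] is at most [eta] after division by [e |X|]. *)
move=> eta eta0; pose eta' := eta * frob X / (nu + 1).
have eta'0 : 0 < eta' by rewrite divr_gt0 ?mulr_gt0 // ltr_wpDl.
have [dP [dS [le_dist diff_ge]]] := diff_approx eta' (e * nu) eta'0 enu0.
have [[X' X'sol] /(_ _ X'sol)fo] := first_order dP dS (le_trans le_dist enu).
exists (frob (X - X') / (e * frob X))%:E.
  exists (uncol (lsubmx dP)), (uncol (rsubmx dP)), (uncol (lsubmx dS)), (uncol (rsubmx dS)), X'.
  split=> //; first by rewrite nuE rbfrob_block !uncolK !hsubmxK.
  by apply/is_real_rbtlseE; rewrite !rbcolD -!add_row_mx !uncolK !hsubmxK.
rewrite lee_fin ler_pdivlMr ?mulr_gt0 //.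
have -> : (kappa * (nu / frob X) - c * nu ^+ 2 / frob X * e - eta) * (e * frob X) =
    e * nu * kappa - e * (eta * frob X) - c * (e * nu) ^+ 2 by field; rewrite gt_eqF.
have eta'_le : e * nu * eta' <= e * (eta * frob X).
  rewrite -mulrA ler_wpM2l ?(ltW e_gt0) // /eta' mulrA ler_pdivrMr ?ltr_wpDl //.
  by rewrite mulrC ler_wpM2l ?lerDl // mulr_ge0 ?frob_ge0 // ltW.
have fo' : frob (X' - X - diff dP dS) <= c * (e * nu) ^+ 2.
  by rewrite (le_trans fo) // ler_wpM2l // ler_sqr ?nnegrE ?frob_ge0.
have tri : frob (diff dP dS) <= frob (X - X') + frob (X' - X - diff dP dS).
  have e0 : (X - X') + (X' - X - diff dP dS) = - diff dP dS.
    by rewrite addrA -[X' - X]opprB subrr sub0r.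
  by have := frobD (X - X') (X' - X - diff dP dS); rewrite e0 frobN.
by rewrite mulrBr in diff_ge; lra.
Qed.
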